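(* Let $W=TT^*$ on $\mathbb{R}$ with $T'=GT$, $G$ a matrix polynomial, as in the context. Suppose there exists a non-trivial (non-constant) entire matrix-valued function $S$, non-singular on $\mathbb{C}$ and unitary on $\mathbb{R}$, such that $H(z)=T(z)S'(z)S^*(z)T^{-1}(z)$ is also a matrix polynomial. Then for every $n\ge0$ the monic orthogonal matrix polynomials satisfy, along with $$\widehat P_n'(z)+\widehat P_n(z)G(z)=-\mathcal{B}_n(z;G)\widehat P_n(z)+\mathcal{A}_n^*(z;G)\beta_n\widehat P_{n-1}(z),$$ $$\widehat P_n'(z)+\widehat P_n(z)G(z)=\big(\mathcal{A}_n^*(z;G)(zI_N-\alpha_n)-\mathcal{B}_n(z;G)\big)\widehat P_n(z)-\mathcal{A}_n^*(z;G)\widehat P_{n+1}(z),$$ the relations $$\widehat P_n(z)H(z)=-\mathcal{B}_n(z;H)\widehat P_n(z)+\mathcal{A}_n^*(z;H)\beta_n\widehat P_{n-1}(z)$$ and $$\widehat P_n(z)H(z)=\big(\mathcal{A}_n^*(z;H)(zI_N-\alpha_n)-\mathcal{B}_n(z;H)\big)\widehat P_n(z)-\mathcal{A}_n^*(z;H)\widehat P_{n+1}(z).$$ In particular, provided $\mathcal{A}_n(z;G)$ is invertible for all $z\in\mathbb{C}$, $$\widehat P_n(z)H(z)+\mathcal{B}_n(z;H)\widehat P_n(z)-\mathcal{A}_n^*(z;H)\mathcal{A}_n^{-*}(z;G)\big(\widehat P_n'(z)+\widehat P_n(z)G(z)+\mathcal{B}_n(z;G)\widehat P_n(z)\big)=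0.$$
   Context: Fix $N\ge1$. The weight $W:\mathbb{R}\to GL(N,\mathbb{R})$ is smooth, $W(x)$ is (symmetric) positive definite for every $x\in\mathbb{R}$, and all entries of $W$ and $W'$ have finite moments of all orders on $\mathbb{R}$. $A^*$ is the conjugate transpose; for matrix functions of a complex variable $F^*(z):=(F(\bar z))^*$ and $F^{-*}(z):=(F^*(z))^{-1}$. It is assumed that $W(x)=T(x)T^*(x)$ for $x\in\mathbb{R}$, where $T$ is a smooth $N\times N$ matrix-valued function satisfying $T'=GT$ with a matrix polynomial $G$; hence $T$ extends to an entire, everywhere invertible matrix function satisfying $T'(z)=G(z)T(z)$ on $\mathbb{C}$. $\widehat P_n(x)=x^nI_N+\sum_{j=0}^{n-1}a_{n,j}x^j$ is the monic matrix polynomial of degree $n$ with $\int_{\mathbb{R}}\widehat P_n W Q^*dx=0$ for all matrix polynomials $Q$ of degree $\le n-1$; $a_{n,n}=I_N$ and $a_{n,j}=0$ for $j<0$ or $j>n$. $\gamma_n=\big(\int_{\mathbb{R}}\widehat P_nW\widehat P_n^*dx\big)^{-1}$. $b_{n,k}=\int_{\mathbb{R}}x^k\widehat P_n(x)W(x)dx$ for $k\ge n$, and $b_{n,k}=0$ for $k<n$. $\alpha_n=a_{n,n-1}-a_{n+1,n}$, $\beta_n=\gamma_n^{-1}\gamma_{n-1}$ ($n\ge1$) are the coefficients of the recurrence $x\widehat P_n=\widehat P_{n+1}+\alpha_n\widehat P_n+\beta_n\widehat P_{n-1}$; $\beta_0=0$, $\widehat P_{-1}=0$. For any matrix polynomial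 $K(z)=\sum_{j=0}^mM_jz^j$ define $\widehat P_{n,k}(z)=z^kI_N+a_{n,n-1}z^{k-1}+\cdots+a_{n,n-k}$, $\Delta_{j,n}(z)=\sum_{k=0}^j\widehat P_{n,k}(z)M_{m-j+k}$, $$\mathcal{A}_n(z;K)=-\gamma_n\sum_{j=0}^{m-1}\big(b_{n,n+m-j-1}\Delta_{j,n}^*(z)+\Delta_{j,n}(z)b_{n,n+m-j-1}^*\big),$$ $$\mathcal{B}_n(z;K)=-\sum_{j=0}^{m}\big(\Delta_{j,n}(z)b_{n-1,n+m-j-1}^*+b_{n,n+m-j-2}\Delta_{j,n-1}^*(z)\big)\gamma_{n-1}\quad(n\ge1),$$ with the convention $\mathcal{B}_0(z;K):=-K(z)$. *)

(* Defs.v *)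
From HB Require Import structures.
From mathcomp Require Import all_boot all_order all_algebra complex.
From mathcomp Require Import all_classical all_reals all_analysis.

Set Implicit Arguments.
Unset Strict Implicit.
Unset Printing Implicit Defensive.

Import Order.TTheory GRing.Theory Num.Theory.
Import numFieldNormedType.Exports.

Local Open Scope classical_set_scope.
Local Open Scope ring_scope.
Local Open Scope complex_scope.
Local Open Scope sesquilinear_scope.

(* The N x N matrices with N >= 1 are 'M_N.+1, so that matrix polynomials are
   elements of {poly 'M[R[i]]_N.+1}. The conjugate transpose of A is A ^t*. *)

Section Real.
Context {R : realType} {N : nat}.

Definition smooth (F : R -> 'M[R]_N.+1) : Prop :=
  forall (k : nat) (x : R), derivable (derive1n k F) x 1.

Definition posdefmx (A : 'M[R]_N.+1) : Prop :=
  A^T = A /\ forall v : 'cV[R]_N.+1, v != 0 -> 0 < (v^T *m A *m v) 0 0.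

Definition finite_moments (F : R -> 'M[R]_N.+1) : Prop :=
  forall (k : nat) (i j : 'I_N.+1),
    (@lebesgue_measure R).-integrable setT (EFin \o (fun x => x ^+ k * F x i j)).

Definition is_weight (W : R -> 'M[R]_N.+1) : Prop :=
  [/\ smooth W, forall x, posdefmx (W x),
      finite_moments W & finite_moments (derive1 W)].

End Real.

Section Complex.
Context {R : realType} {N : nat}.
Local Notation C := R[i].
Local Notation M := 'M[R[i]]_N.+1.

Definition mxRe (A : M) : 'M[R]_N.+1 := map_mx (@complex.Re R) A.
Definition mxIm (A : M) : 'M[R]_N.+1 := map_mx (@complex.Im R) A.
Definition mxC (A : 'M[R]_N.+1) : M := map_mx (fun x : R => x%:C) A.

Definition csmooth (F : R -> M) : Prop :=
  smooth (fun x => mxRe (F x)) /\ smooth (fun x => mxIm (F x)).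

Definition cderive1 (F : R -> M) (x : R) : M :=
  \matrix_(i, j) (derive1 (fun y => mxRe (F y)) x i j
                  +i* derive1 (fun y => mxIm (F y)) x i j).

Definition entire (F : C -> M) : Prop := forall z : C, derivable (F : C^o -> M) z 1.

(* F^*(z) = (F(conj z))^* for a matrix function F of a complex variable *)
Definition star (F : C -> M) (z : C) : M := (F (Num.conj z)) ^t*.

Definition mxint (F : R -> M) : M :=
  \matrix_(i, j)
    (Rintegral (@lebesgue_measure R) setT (fun x => complex.Re (F x i j))
     +i* Rintegral (@lebesgue_measure R) setT (fun x => complex.Im (F x i j))).

(* Value at a scalar: z%:M is central, so this is \sum_i z ^+ i *: p`_i *)
Definition peval (p : {poly M}) (z : C) : M := p.[z%:M].

Definition wdot (W : R -> 'M[R]_N.+1) (P Q : {poly M}) : M :=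
  mxint (fun x => peval P x%:C *m mxC (W x) *m (peval Q x%:C) ^t*).

Definition monic_orthogonal (W : R -> 'M[R]_N.+1) (P : nat -> {poly M}) : Prop :=
  forall n : nat, [/\ size (P n) = n.+1, P n \is monic &
    forall Q : {poly M}, (size Q <= n)%N -> wdot W (P n) Q = 0].

Section Coefficients.
Variables (W : R -> 'M[R]_N.+1) (P : nat -> {poly M}).

(* a_(n, n - k); the test is needed because subtraction on nat is truncated *)
Definition acoef (n k : nat) : M := if (k <= n)%N then (P n)`_(n - k) else 0.

Definition gammac (n : nat) : M := invmx (wdot W (P n) (P n)).

Definition bcoef (n k : nat) : M :=
  if (n <= k)%N then
    mxint (fun x => x%:C ^+ k *: (peval (P n) x%:C *m mxC (W x)))
  else 0.

Definition alphac (n : nat) : M := acoef n 1 - acoef n.+1 1.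

Definition betac (n : nat) : M :=
  if n is n'.+1 then invmx (gammac n) *m gammac n' else 0.

(* P_(n - 1), with P_(-1) = 0 *)
Definition Pprev (n : nat) : {poly M} := if n is n'.+1 then P n' else 0.

Definition Phat (n k : nat) (z : C) : M :=
  \sum_(i < k.+1) z ^+ (k - i) *: acoef n i.

(* In K = \sum_(j <= m) M_j z^j we take m = deg K (0 for K = 0) and M_j = K`_j.
   A larger m, with zero leading coefficients, gives the same calA and calB. *)
Definition pdeg (K : {poly M}) : nat := (size K).-1.

Definition Delta (K : {poly M}) (j n : nat) (z : C) : M :=
  \sum_(k < j.+1) Phat n k z *m K`_(pdeg K - j + k).

Definition calA (n : nat) (K : {poly M}) (z : C) : M :=
  - (gammac n *m
     \sum_(j < pdeg K)
       (bcoef n (n + pdeg K - j - 1) *m star (Delta K j n) z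
        + Delta K j n z *m (bcoef n (n + pdeg K - j - 1)) ^t*)).

(* For n >= 1 and j <= deg K the only index below that can be negative is
   n + deg K - j - 2 = -1, when n = 1 and j = deg K; it is truncated to 0 < n,
   so that bcoef vanishes as it should. *)
Definition calB (n : nat) (K : {poly M}) (z : C) : M :=
  if n is n'.+1 then
    - ((\sum_(j < (pdeg K).+1)
          (Delta K j n z *m (bcoef n' (n + pdeg K - j - 1)) ^t*
           + bcoef n (n + pdeg K - j - 2) *m star (Delta K j n') z))
       *m gammac n')
  else - peval K z.

End Coefficients.

End Complex.

(* Main.v *)
(* Both relations are instances of one statement about an operator
   D p = e p' + p K on matrix polynomials that is skew-symmetric for the form
   <p, q> = \int p W q^*.  With e = 1, K = G this is integration by parts, since
   W' = G W + W G^*; with e = 0, K = H it holds pointwise, since S S^* = 1 on R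
   makes S' S^* skew-Hermitian, whence H W + W H^* = 0.

   For fixed n and z put
     X q = <(P_n K - (P_n K)(z)) / (y - z), q> + <P_n, (q K - (q K)(w)) / (y - w)>
   with w the conjugate of z.  The values X P_l obey an inhomogeneous version of
   the three-term recurrence, so X P_(n-1) gamma_(n-1) P_n(z)
   - X P_n gamma_(n-1) P_(n-1)(z) telescopes, as in the Christoffel-Darboux
   formula; by skewness the resulting sum is the orthogonal expansion of
   (D P_n)(z).  Expanding the divided differences in powers of y identifies
   X P_(n-1) gamma_(n-1) with - B_n(z; K) and X P_n gamma_n with - A_n^*(z; K). *)

Require Import Defs.
From HB Require Import structures.
From mathcomp Require Import all_boot all_order all_algebra complex.
From mathcomp Require Import all_classical all_reals all_analysis.
From mathcomp Require Import ssrAC measurable_realfun zify ring.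

Import Order.TTheory GRing.Theory Num.Theory.
Import numFieldNormedType.Exports.

Local Open Scope classical_set_scope.
Local Open Scope ring_scope.
Local Open Scope complex_scope.
Local Open Scope sesquilinear_scope.
(** * Matrix algebra and divided differences *)

Section Adjoint.
Context {C : numClosedFieldType} {n : nat}.
Implicit Types A B : 'M[C]_n.+1.

Lemma adjD A B : (A + B)^t* = A^t* + B^t*.
Proof. by rewrite !raddfD. Qed.

Lemma adjN A : (- A)^t* = - A^t*.
Proof. by rewrite !raddfN. Qed.

Lemma adj0 : (0 : 'M[C]_n.+1)^t* = 0.
Proof. by rewrite !raddf0. Qed.

Lemma adjM A B : (A * B)^t* = B^t* * A^t*.
Proof. by rewrite -mulmxE trmx_mul map_mxM. Qed.

Lemma adjK A : (A^t*)^t* = A.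
Proof. exact: trmxCK. Qed.

Lemma adj1 : (1 : 'M[C]_n.+1)^t* = 1.
Proof. by rewrite trmx1 map_mx1. Qed.

Lemma adjZ (z : C) A : (z *: A)^t* = Num.conj z *: A^t*.
Proof. by apply/matrixP => i j; rewrite !mxE rmorphM. Qed.

Lemma adj_sum (I : Type) (r : seq I) (Q : pred I) (F : I -> 'M[C]_n.+1) :
  (\sum_(i <- r | Q i) F i)^t* = \sum_(i <- r | Q i) (F i)^t*.
Proof. by rewrite !raddf_sum. Qed.

Lemma adj_scalar (z : C) : (z%:M : 'M[C]_n.+1)^t* = (Num.conj z)%:M.
Proof. by rewrite -scalemx1 adjZ adj1 scalemx1. Qed.

Lemma adjV A : A \is a GRing.unit -> (A^-1)^t* = (A^t*)^-1.
Proof.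
move=> uA; have uB : A^t* \is a GRing.unit.
  apply/unitrP; exists ((A^-1)^t*).
  by rewrite -!adjM divrr // mulVr // adj1.
by apply: (mulrI uB); rewrite [RHS]divrr // -adjM mulVr // adj1.
Qed.

End Adjoint.

Lemma sum_ord_trunc (V : nmodType) (F : nat -> V) (a b : nat) : (a <= b)%N ->
  (forall i, (a <= i < b)%N -> F i = 0) -> \sum_(i < b) F i = \sum_(i < a) F i.
Proof.
move=> ab F0; rewrite -!(big_mkord predT) (big_cat_nat (n := a)) //=.
by rewrite [X in _ + X]big_nat [X in _ + X]big1 ?addr0.
Qed.

Lemma mulr_scalar (C : comNzRingType) (n : nat) (z : C) (A : 'M[C]_n.+1) :
  A * z%:M = z *: A.
Proof. exact: mul_mx_scalar. Qed.

Lemma mul_scalarr (C : comNzRingType) (n : nat) (z : C) (A : 'M[C]_n.+1) :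
  z%:M * A = z *: A.
Proof. exact: mul_scalar_mx. Qed.

Section DividedDifference.
Context {C : comNzRingType} {n : nat}.
Implicit Types (R Q : {poly 'M[C]_n.+1}) (z : C).

(** This is (R - R(z)) / (X - z): its coefficient of index s is the sum of R_k z^(k-s-1) over k > s,
    the value at z of R with its lowest s+1 coefficients removed. [divdiff_mulX] is the defining
    identity. *)
Definition divdiff z R : {poly 'M[C]_n.+1} :=
  \poly_(s < size R) (drop_poly s.+1 R).[z%:M].

Lemma coef_divdiff z R s : (divdiff z R)`_s = (drop_poly s.+1 R).[z%:M].
Proof.
rewrite coef_poly; case: ltnP => // h.
by rewrite drop_poly_eq0 ?horner0 // (leq_trans h).
Qed.

Lemma size_divdiff z R : (size (divdiff z R) <= (size R).-1)%N.
Proof.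
apply/leq_sizeP => s hs; rewrite coef_divdiff drop_poly_eq0 ?horner0 //.
by case: (size R) hs.
Qed.

Lemma horner_drop z R :
  R.[z%:M] = R`_0 + z *: (drop_poly 1 R).[z%:M].
Proof.
(* The evaluation point is a scalar matrix, so it commutes with all coefficients and evaluation is
   multiplicative. *)
have comm (p : {poly 'M[C]_n.+1}) : comm_poly p z%:M.
  by rewrite /comm_poly mulr_scalar mul_scalarr.
rewrite -{1}(poly_take_drop 1 R) hornerD hornerM_comm // expr1 hornerX.
rewrite mulr_scalar; congr (_ + _).
by rewrite [take_poly 1 R]size1_polyC ?size_take_poly // hornerC coef_take_poly.
Qed.

Lemma drop_poly_rec z R s : (drop_poly s R).[z%:M] =
  R`_s + z *: (drop_poly s.+1 R).[z%:M].
Proof.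
rewrite horner_drop coef_drop_poly add0n; congr (_ + _ *: horner _ _).
by apply/polyP => i; rewrite !coef_drop_poly -addnA add1n.
Qed.

Lemma divdiffD z R Q : divdiff z (R + Q) = divdiff z R + divdiff z Q.
Proof.
by apply/polyP => s; rewrite coefD !coef_divdiff drop_polyD hornerD.
Qed.

Lemma divdiffZ z A R : divdiff z (A *: R) = A *: divdiff z R.
Proof.
by apply/polyP => s; rewrite coefZ !coef_divdiff drop_polyZ hornerZ.
Qed.

Lemma divdiff_mulX z R :
  divdiff z R * 'X = z%:M *: divdiff z R + R - (R.[z%:M])%:P.
Proof.
apply/polyP => -[|s]; rewrite coefMX coefB coefD coefZ coefC !coef_divdiff /=.
  rewrite [in R.[_]]horner_drop mul_scalarr.
  by rewrite [X in _ - X]addrC subrr.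
by rewrite subr0 drop_poly_rec mul_scalarr addrC.
Qed.

Lemma divdiffMX z R : divdiff z (R * 'X) = z%:M *: divdiff z R + R.
Proof.
apply/polyP => s; rewrite coefD coefZ !coef_divdiff.
rewrite mul_scalarr addrC -drop_poly_rec.
by congr horner; apply/polyP => i; rewrite !coef_drop_poly coefMX addnS.
Qed.

End DividedDifference.

(** * Orthogonal matrix polynomials *)

(** The conditions on a', b' and g make the recurrence of X adjoint to that of p with respect to g.
    Substituting both recurrences in X_(n+1) g_(n+1) p_(n+2) - X_(n+2) g_(n+1) p_(n+1), the terms
    with z - a cancel and what remains is the same expression one index lower, minus c_(n+1) g_(n+1)
    p_(n+1). *)
Lemma three_term_telescope (A : pzRingType) (z : A)
    (p X c g a b a' b' : nat -> A) :
  z * p 0%N = p 1%N + a 0%N * p 0%N ->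
  (forall l, z * p l.+1 = p l.+2 + a l.+1 * p l.+1 + b l.+1 * p l) ->
  X 0%N * z + c 0%N = X 1%N + X 0%N * a' 0%N ->
  (forall l, X l.+1 * z + c l.+1
    = X l.+2 + X l.+1 * a' l.+1 + X l * b' l.+1) ->
  (forall l, a' l * g l = g l * a l) ->
  (forall l, g l.+1 * b l.+1 = g l) -> (forall l, b' l.+1 * g l.+1 = g l) ->
  (forall l, z * g l = g l * z) ->
  forall n, X n * g n * p n.+1 - X n.+1 * g n * p n
    = - \sum_(l < n.+1) c l * g l * p l.
Proof.
move=> z0 z1 Xz0 Xz1 ag gb bg zg.
have p1 : g 0%N * p 1%N = g 0%N * (z - a 0%N) * p 0%N.
  by rewrite -mulrA mulrBl z0 addrK.
have p2 l : g l.+1 * p l.+2 = g l.+1 * (z - a l.+1) * p l.+1 - g l * p l.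
  by rewrite -mulrA mulrBl z1 addrAC addrK mulrDr !mulrA gb addrK.
have X1 : X 1%N = X 0%N * z + c 0%N - X 0%N * a' 0%N by rewrite Xz0 addrK.
have X2 l : X l.+2 = X l.+1 * z + c l.+1 - X l.+1 * a' l.+1 - X l * b' l.+1.
  by rewrite Xz1 addrAC !addrK.
have X1g : X 1%N * g 0%N = X 0%N * g 0%N * (z - a 0%N) + c 0%N * g 0%N.
  rewrite X1 mulrBl mulrDl mulrBr -!mulrA ag zg !mulrA.
  by rewrite addrAC.
have X2g l : X l.+2 * g l.+1
    = X l.+1 * g l.+1 * (z - a l.+1) + c l.+1 * g l.+1 - X l * g l.
  rewrite X2 !mulrBl mulrDl mulrBr -!mulrA ag bg zg !mulrA.
  by rewrite [X in X - _ = _]addrAC.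
elim=> [|n IHn].
  by rewrite big_ord1 -mulrA p1 X1g mulrDl !mulrA opprD addrA subrr add0r.
rewrite big_ord_recr /= opprD -IHn -mulrA p2 X2g.
rewrite [X in X - _ = _]mulrBr mulrBl mulrDl !mulrA.
rewrite !opprD !opprK -[- _ - _ + _]addrA addrACA subrr add0r.
by rewrite addrA addrC addrA.
Qed.

Section Evaluation.
Context {R : realType} {N : nat}.
Implicit Types (p q : {poly 'M[R[i]]_N.+1}) (z : R[i]).

Lemma pevalD p q z : peval (p + q) z = peval p z + peval q z.
Proof. exact: hornerD. Qed.

Lemma pevalZ A p z : peval (A *: p) z = A * peval p z.
Proof. exact: hornerZ. Qed.

Lemma pevalMX p z : peval (p * 'X) z = z *: peval p z.
Proof.
rewrite /peval hornerM_comm ?hornerX ?mulr_scalar //.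
by rewrite /comm_poly hornerX.
Qed.

Lemma pevalM p q z : peval (p * q) z = peval p z * peval q z.
Proof.
by rewrite /peval hornerM_comm // /comm_poly mulr_scalar mul_scalarr.
Qed.

Lemma peval_sum (I : Type) (r : seq I) (Q : pred I) (F : I -> {poly 'M[R[i]]_N.+1}) z :
  peval (\sum_(i <- r | Q i) F i) z = \sum_(i <- r | Q i) peval (F i) z.
Proof. exact: horner_sum. Qed.

End Evaluation.

(** * The sums [Delta] as truncations of the product P_n K *)

Section DeltaCoefficients.
Context {R : realType} {N : nat}.
Local Notation M := 'M[R[i]]_N.+1.
Variable P : nat -> {poly M}.
Hypothesis P_size : forall n, size (P n) = n.+1.

Lemma acoef_eq0 n k : (n < k)%N -> acoef P n k = 0.
Proof. by rewrite /acoef ltnNge => /negbTE ->. Qed.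

Lemma pdeg_coef_eq0 (K : {poly M}) k : (pdeg K < k)%N -> K`_k = 0.
Proof. by move=> h; rewrite nth_default // (leq_trans _ h) // leqSpred. Qed.

Lemma coef_P_mul (K : {poly M}) n j : (j <= pdeg K)%N ->
  (P n * K)`_(n + pdeg K - j)
  = \sum_(i < j.+1) acoef P n i * K`_(pdeg K - j + i).
Proof.
move=> jm; pose F i := acoef P n i * K`_(pdeg K - j + i).
have Fn i : (n < i)%N -> F i = 0 by move=> h; rewrite /F acoef_eq0 ?mul0r.
have Fj i : (j < i)%N -> F i = 0.
  by move=> h; rewrite /F pdeg_coef_eq0 ?mulr0 // addnC addnBA // ltn_subRL ltn_add2r.
(* [F] vanishes beyond n and beyond j. Both ranges lie in that of n + j, so the sum can be cut at n
   instead of j. *)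
transitivity (\sum_(i < (n + j).+1) F i); last first.
  apply: (@sum_ord_trunc _ F); first by rewrite ltnS leq_addl.
  by move=> i /andP[h _]; exact: Fj.
rewrite (@sum_ord_trunc _ F n.+1) ?ltnS ?leq_addr //; last first.
  by move=> i /andP[h _]; exact: Fn.
rewrite coefM (@sum_ord_trunc _ (fun i => (P n)`_i * K`_(n + pdeg K - j - i)) n.+1).
- rewrite (reindex_inj rev_ord_inj) /=; apply: eq_bigr => i _.
  rewrite /F /acoef subSS -ltnS ltn_ord; congr (_ * K`_ _).
  by have := ltn_ord i; lia.
- by rewrite ltnS -addnBA // leq_addr.
- by move=> i /andP[h _]; rewrite nth_default ?mul0r // P_size.
Qed.

(** Horner's scheme: since Phat_(n,i+1) = z Phat_(n,i) + a_(n,n-i-1), passing from j to j+1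
    multiplies by z and adds the next lower coefficient of P_n K, given by [coef_P_mul]. The scheme
    starts at the top index n + deg K. *)
Lemma DeltaE (K : {poly M}) n j z : (j <= pdeg K)%N ->
  Delta P K j n z = peval (drop_poly (n + pdeg K - j) (P n * K)) z.
Proof.
elim: j => [|j IHj] jm.
  rewrite subn0 /peval drop_poly_rec drop_poly_eq0 ?horner0 ?scaler0 ?addr0.
    have := coef_P_mul K n 0 isT; rewrite !subn0 => ->.
    by rewrite /Delta !big_ord1 /Phat big_ord1 subnn expr0 scale1r subn0.
  rewrite (leq_trans (size_polyMleq _ _)) // P_size /=.
  by rewrite -addnS leq_add2l leqSpred.
have E : (n + pdeg K - j = (n + pdeg K - j.+1).+1)%N by move: jm; lia.
rewrite /peval drop_poly_rec -E -[(drop_poly _ _).[_]]IHj; last exact: ltnW.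
rewrite coef_P_mul // /Delta big_ord_recl [in RHS]big_ord_recl -addrA.
rewrite /Phat big_ord1 subnn expr0 scale1r /=; congr (_ + _).
rewrite scaler_sumr -big_split /=.
rewrite [LHS](eq_bigr (fun i : 'I_j.+1 =>
  acoef P n (bump 0 i) * K`_(pdeg K - j.+1 + bump 0 i) +
  z *: ((\sum_(k < i.+1) z ^+ (i - k) *: acoef P n k) *m K`_(pdeg K - j + i)))).
  by [].
move=> i _.
have -> : (pdeg K - j.+1 + bump 0 i = pdeg K - j + i)%N.
  by rewrite /bump /=; move: jm; lia.
rewrite /bump /= add1n big_ord_recr /= subnn expr0 scale1r mulmxE.
rewrite mulrDl addrC scalerAl; congr (_ + _ * _).
rewrite scaler_sumr; apply: eq_bigr => k _.
by rewrite scalerA -exprS subSn // -ltnS.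
Qed.

End DeltaCoefficients.

(** * Monic orthogonal polynomials of an abstract Hermitian form *)

Section OrthogonalPolynomials.
Context {R : realType} {N : nat}.
Local Notation C := R[i].
Local Notation M := 'M[R[i]]_N.+1.
Implicit Types p q s : {poly M}.
Variable dot : {poly M} -> {poly M} -> M.
Hypothesis dotDl : forall p q s, dot (p + q) s = dot p s + dot q s.
Hypothesis dotZl : forall A p q, dot (A *: p) q = A * dot p q.
Hypothesis dotMX : forall p q, dot (p * 'X) q = dot p (q * 'X).
Hypothesis dot_adj : forall p q, (dot p q)^t* = dot q p.

Lemma dot0l q : dot 0 q = 0.
Proof. by rewrite -[0 in LHS](scale0r (0 : {poly M})) dotZl mul0r. Qed.

Lemma dotNl p q : dot (- p) q = - dot p q.
Proof. by rewrite -scaleN1r dotZl mulN1r. Qed.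

Lemma dotBl p q s : dot (p - q) s = dot p s - dot q s.
Proof. by rewrite dotDl dotNl. Qed.

Lemma dotDr p q s : dot p (q + s) = dot p q + dot p s.
Proof. by rewrite -dot_adj dotDl adjD !dot_adj. Qed.

Lemma dotZr A p q : dot p (A *: q) = dot p q * A^t*.
Proof. by rewrite -dot_adj dotZl adjM dot_adj. Qed.

Lemma dot_suml (I : Type) (r : seq I) (Q : pred I) (F : I -> {poly M}) q :
  dot (\sum_(i <- r | Q i) F i) q = \sum_(i <- r | Q i) dot (F i) q.
Proof.
by elim/big_rec2: _ => [|i x y _ <-]; rewrite ?dot0l ?dotDl.
Qed.

Variable P : nat -> {poly M}.
Hypothesis P_size : forall n, size (P n) = n.+1.
Hypothesis P_monic : forall n, P n \is monic.
Hypothesis P_orth : forall n q, (size q <= n)%N -> dot (P n) q = 0.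
Hypothesis gram_unit : forall n, dot (P n) (P n) \is a GRing.unit.

Let g n := (dot (P n) (P n))^-1.
(** The recurrence coefficient \beta_n at successor indices. At 0 the truncated predecessor gives 1
    instead of \beta_0 = 0, so statements take [be n.+1]. *)
Let be n := dot (P n) (P n) * g n.-1.

Lemma P_orthr n q : (size q <= n)%N -> dot q (P n) = 0.
Proof. by move=> h; rewrite -dot_adj P_orth ?adj0. Qed.

Lemma P_coefn n : (P n)`_n = 1.
Proof. by have := monicP (P_monic n); rewrite /lead_coef P_size. Qed.

Lemma size_sub_lead n q :
  (size q <= n.+1)%N -> (size (q - q`_n *: P n)%R <= n)%N.
Proof.
move=> sq; apply/leq_sizeP => j; rewrite leq_eqVlt => /predU1P[<-|nj].
  by rewrite coefB coefZ P_coefn mulr1 subrr.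
rewrite coefB coefZ [q`_j]nth_default ?(leq_trans sq) //.
by rewrite [(P n)`_j]nth_default ?P_size // mulr0 subrr.
Qed.

Lemma dot_lead n q : (size q <= n.+1)%N -> dot q (P n) = q`_n * dot (P n) (P n).
Proof.
move=> sq; rewrite -[q in LHS](subrK (q`_n *: P n)) dotDl dotZl.
by rewrite P_orthr ?add0r // size_sub_lead.
Qed.

Let gramK n : dot (P n) (P n) * g n = 1.
Proof. exact: divrr. Qed.

Let Kgram n : g n * dot (P n) (P n) = 1.
Proof. exact: mulVr. Qed.

(** Pairing with the P_k of highest index reads off the leading coefficient times an invertible Gram
    matrix, so the degree drops step by step. *)
Lemma orth_eq0 n q : (size q <= n)%N ->
  (forall k, (k < n)%N -> dot q (P k) = 0) -> q = 0.
Proof.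
elim: n => [|n IHn] sq q0; first by apply/eqP; rewrite -size_poly_leq0.
apply: IHn => [|k kn]; last exact/q0/ltnW.
have := q0 n (ltnSn n); rewrite dot_lead // => /(congr1 ( *%R^~ (g n))).
rewrite mul0r -mulrA gramK mulr1 => qn.
by rewrite -[q](subr0) -(scale0r (P n)) -qn size_sub_lead.
Qed.

Lemma g_adj n : (g n)^t* = g n.
Proof. by rewrite adjV ?gram_unit // dot_adj. Qed.

Lemma be_adj_g n : (be n.+1)^t* * g n.+1 = g n.
Proof. by rewrite adjM g_adj dot_adj -mulrA gramK mulr1. Qed.

Lemma g_be n : g n.+1 * be n.+1 = g n.
Proof. by rewrite mulrA Kgram mul1r. Qed.

Lemma orth_expansion n q : (size q <= n)%N ->
  q = \sum_(l < n) (dot q (P l) * g l) *: P l.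
Proof.
move=> sq; apply/eqP; rewrite -subr_eq0; apply/eqP.
apply: (@orth_eq0 n) => [|k kn].
  rewrite (leq_trans (size_polyD _ _)) // geq_max sq size_polyN.
  rewrite (leq_trans (size_sum _ _ _)) //; apply/bigmax_leqP => l _.
  by rewrite (leq_trans (size_scale_leq _ _)) ?P_size.
rewrite dotBl dot_suml (bigD1 (Ordinal kn)) //= big1 ?addr0 => [|l lk].
  by rewrite dotZl -mulrA Kgram mulr1 subrr.
rewrite dotZl; have [kl|kl|kl] := ltngtP l k.
- by rewrite (@P_orthr k (P l)) ?mulr0 // P_size.
- by rewrite (@P_orth l (P k)) ?mulr0 // P_size.
- by rewrite -val_eqE /= kl eqxx in lk.
Qed.

(** Orthogonality removes the powers below l. The t remaining ones are listed from the top down, the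
    order in which [calA] and [calB] use [bcoef]. *)
Lemma dot_expand t l q : (size q <= l + t)%N ->
  dot q (P l) = \sum_(j < t)
    q`_(l + t - j - 1) * (dot (P l) 'X^(l + t - j - 1))^t*.
Proof.
move=> sq; pose F (k : nat) := q`_k * (dot (P l) 'X^k)^t*.
have -> : dot q (P l) = \sum_(k < l + t) F k.
  have qE : q = \sum_(k < l + t) q`_k *: 'X^k.
    rewrite -(poly_def (l + t) (fun k => q`_k)).
    apply/polyP => k; rewrite coef_poly; case: ltnP => // h.
    by rewrite nth_default // (leq_trans sq).
  rewrite [q in LHS]qE dot_suml; apply: eq_bigr => k _.
  by rewrite dotZl /F dot_adj.
rewrite big_split_ord /= big1 ?add0r => [|k _]; last first.
  by rewrite /F P_orth ?size_polyXn // adj0 mulr0.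
rewrite (reindex_inj rev_ord_inj) /=; apply: eq_bigr => j _.
by rewrite -subnDA addn1 addnBA.
Qed.

Let size_PX n : size (P n * 'X) = n.+2.
Proof. by rewrite size_mulX ?P_size // -size_poly_gt0 P_size. Qed.

Lemma size_recurrence n :
  (size (P n * 'X - P n.+1 - alphac P n *: P n)%R <= n)%N.
Proof.
have h : (size (P n * 'X - P n.+1)%R <= n.+1)%N.
  have := @size_sub_lead n.+1 (P n * 'X); rewrite size_PX coefMX /= P_coefn.
  by rewrite scale1r; apply.
suff -> : alphac P n = (P n * 'X - P n.+1)`_n by exact: size_sub_lead.
rewrite coefB coefMX /alphac /acoef subn1 /=.
(* For n = 0 both [acoef P 0 1] and the constant coefficient of P_0 X are 0. *)
by case: n {h} => [|n] /=; rewrite ?ltnS ?leq0n // subn1.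
Qed.

Lemma recurrence0 : P 0%N * 'X = P 1%N + alphac P 0%N *: P 0%N.
Proof.
apply/eqP; rewrite -subr_eq0 opprD addrA -size_poly_leq0.
exact: size_recurrence.
Qed.

(** The difference of the two sides has degree at most n, so it suffices to pair it with P_k for k
    <= n. Moving X to the second slot leaves X P_k, of degree at most n unless k = n; in that case X
    P_n is P_(n+1) up to lower degree, which produces \beta_(n+1). *)
Lemma recurrence n :
  P n.+1 * 'X = P n.+2 + alphac P n.+1 *: P n.+1 + be n.+1 *: P n.
Proof.
apply/eqP; rewrite -subr_eq0 !opprD !addrA; apply/eqP.
have sD := size_recurrence n.+1.
apply: (@orth_eq0 n.+1) => [|k kn].
  rewrite (leq_trans (size_polyD _ _)) // geq_max sD size_polyN.
  by rewrite (leq_trans (size_scale_leq _ _)) ?P_size.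
rewrite dotBl dotZl !dotBl dotZl dotMX.
rewrite (@P_orth n.+2) ?P_size 1?ltnW ?ltnS // subr0.
rewrite (@P_orth n.+1 (P k)) ?P_size // mulr0 subr0.
have := @size_sub_lead k.+1 (P k * 'X); rewrite size_PX coefMX /= P_coefn scale1r.
move=> /(_ (ltnSn _)) sk; rewrite -[P k * 'X](subrK (P k.+1)) dotDr P_orth; last first.
  exact: leq_trans kn.
rewrite add0r; move: kn; rewrite ltnS leq_eqVlt => /predU1P[->|kn].
  by rewrite /be -mulrA Kgram mulr1 subrr.
by rewrite !P_orth ?mulr0 ?subrr // P_size.
Qed.

(** Multiplication by X is symmetric for the form: \alpha_n <P_n, P_n> and <P_n, P_n> \alpha_n^*
    both equal <P_n X, P_n>. Multiplying by g_n on either side gives the claim. *)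
Lemma alpha_adj_g n : (alphac P n)^t* * g n = g n * alphac P n.
Proof.
have aE : alphac P n * dot (P n) (P n) = dot (P n * 'X) (P n).
  case: n => [|n].
    by rewrite recurrence0 dotDl dotZl (@P_orth 1) ?P_size // add0r.
  rewrite recurrence !dotDl !dotZl (@P_orth n.+2) ?P_size // add0r.
  by rewrite (@P_orthr n.+1 (P n)) ?P_size // mulr0 addr0.
have aE' : dot (P n) (P n) * (alphac P n)^t* = dot (P n * 'X) (P n).
  by rewrite dotMX -[RHS]dot_adj -aE adjM dot_adj.
rewrite -[LHS]mul1r -(Kgram n) -!mulrA [X in _ * X]mulrA aE' -aE.
by rewrite -mulrA gramK mulr1.
Qed.

(** * Ladder relations for a skew-symmetric operator *)

Section Ladder.
Variables (K : {poly M}) (e : nat).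
Let D p := p^`() *+ e + p * K.
Hypothesis skew : forall p q, dot (D p) q = - dot p (D q).

Lemma P0_eq1 : P 0%N = 1.
Proof.
have /size_poly1P [c c0 Pc] : size (P 0%N) == 1 by rewrite P_size.
by have := P_coefn 0; rewrite Pc coefC /= => ->.
Qed.

Definition ladderX (n : nat) (z : C) q : M :=
  dot (divdiff z (P n * K)) q + dot (P n) (divdiff (Num.conj z) (q * K)).

Lemma ladderXD n z p q : ladderX n z (p + q) = ladderX n z p + ladderX n z q.
Proof. by rewrite /ladderX mulrDl divdiffD !dotDr addrACA. Qed.

Lemma ladderXZ n z A q : ladderX n z (A *: q) = ladderX n z q * A^t*.
Proof. by rewrite /ladderX -scalerAl divdiffZ !dotZr mulrDl. Qed.

(** In the first summand of [ladderX] the factor X crosses the form and completes the divided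
    difference. In the second, with w the conjugate of z, the divided difference of q X K is w times
    that of q K, plus q K, and w leaves the second slot as z. *)
Lemma ladderXMX n z q : ladderX n z (q * 'X) = ladderX n z q * z%:M
  + (dot (P n * K - (peval (P n * K) z)%:P) q + dot (P n) (q * K)).
Proof.
rewrite /ladderX -dotMX divdiff_mulX -addrA dotDl dotZl.
have -> : q * 'X * K = q * K * 'X by rewrite -!mulrA commr_polyX.
rewrite divdiffMX dotDr dotZr mulrDl mul_scalarr mulr_scalar addrACA.
by rewrite adj_scalar conjCK mulr_scalar.
Qed.

Lemma ladderE n z : peval (D (P n.+1)) z
  = ladderX n.+1 z (P n) * g n * peval (P n.+1) z
    - ladderX n.+1 z (P n.+1) * g n * peval (P n) z.
Proof.
(* The inhomogeneous term that [ladderXMX] gives for q = P_l. *)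
pose c l := dot (P n.+1 * K - (peval (P n.+1 * K) z)%:P) (P l)
            + dot (P n.+1) (P l * K).
rewrite (@three_term_telescope _ z%:M (fun l => peval (P l) z)
  (fun l => ladderX n.+1 z (P l)) c g (alphac P) be (fun l => (alphac P l)^t*)
  (fun l => (be l)^t*)) /=; last first.
- by move=> l; rewrite mul_scalarr mulr_scalar.
- exact: be_adj_g.
- exact: g_be.
- exact: alpha_adj_g.
- move=> l.
  by rewrite -ladderXMX recurrence !ladderXD !ladderXZ.
- by rewrite -ladderXMX recurrence0 ladderXD ladderXZ.
- by move=> l; rewrite mul_scalarr -pevalMX recurrence !pevalD !pevalZ.
- by rewrite mul_scalarr -pevalMX recurrence0 !pevalD !pevalZ.
(* [q] has the same value at z as D P_(n+1), but degree at most n, so it can be expanded in P_0,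
   ..., P_n. *)
pose q := (P n.+1)^`() *+ e + (peval (P n.+1 * K) z)%:P.
have sder l : (size ((P l)^`() *+ e)%R <= l)%N.
  rewrite -scaler_nat (leq_trans (size_scale_leq _ _)) //.
  by rewrite (leq_trans (size_poly _ _)) // P_size.
(* Write P_(n+1) K as D P_(n+1) minus its derivative part. Skewness turns <D P_(n+1), P_l> into -
   <P_(n+1), P_l K>, the derivative of P_l being orthogonal to P_(n+1), and this cancels the second
   term of [c l]. *)
have cE l : (l < n.+1)%N -> c l = - dot q (P l).
  have DE : P n.+1 * K = D (P n.+1) - (P n.+1)^`() *+ e by rewrite /D addrC addKr.
  move=> ln; rewrite /c dotBl [in dot (_ * K) _]DE dotBl skew /D dotDr.
  rewrite [dot _ (_ *+ _)]P_orth; last exact: leq_trans (sder l) (ltnW ln).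
  by rewrite add0r /q dotDl opprD addrC !addrA subrr add0r.
transitivity (peval q z).
  rewrite /D !pevalD; congr (_ + _).
  by rewrite [in RHS]/peval hornerC.
rewrite (@orth_expansion n.+1 q); last first.
  rewrite (leq_trans (size_polyD _ _)) // geq_max sder.
  by rewrite (leq_trans (size_polyC_leq1 _)).
rewrite peval_sum -sumrN; apply: eq_bigr => l _.
by rewrite pevalZ cE // !mulNr opprK.
Qed.

Variable W : R -> 'M[R]_N.+1.
Hypothesis gammacE : forall n, gammac W P n = g n.
Hypothesis bcoefE : forall l k,
  bcoef W P l k = if (l <= k)%N then dot (P l) 'X^k else 0.

Let m := pdeg K.

Let size_dd z n : (size (divdiff z (P n * K)) <= n + m)%N.
Proof.
rewrite (leq_trans (size_divdiff _ _)) //.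
have := size_polyMleq (P n) K; rewrite P_size /m /pdeg.
by case: (size (P n * K)) (size K) => [|a] [|b] //=; rewrite ?addnS ?addn0 //; lia.
Qed.

(** The coefficient of index s is a truncation at s + 1 = n + m - j, which [DeltaE] evaluates. The
    condition j < n + m keeps the subtraction of 1 from being truncated. *)
Let coef_dd z n j : (j <= m)%N -> (j < n + m)%N ->
  (divdiff z (P n * K))`_(n + m - j - 1) = Delta P K j n z.
Proof.
move=> jm jnm; rewrite coef_divdiff (DeltaE P P_size) //.
by rewrite subn1 prednK // subn_gt0.
Qed.

(** The second summand of [ladderX] is the adjoint of the first taken at the conjugate of z, so a
    single expansion by [dot_expand] yields both halves. *)
Lemma ladderX_calA n z : ladderX n z (P n) = \sum_(j < m)
  (bcoef W P n (n + m - j - 1) * star (Delta P K j n) z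
   + Delta P K j n z * (bcoef W P n (n + m - j - 1))^t*).
Proof.
have E w : dot (divdiff w (P n * K)) (P n) = \sum_(j < m)
    Delta P K j n w * (bcoef W P n (n + m - j - 1))^t*.
  rewrite (@dot_expand m) //; apply: eq_bigr => j _.
  have jm := ltn_ord j; rewrite coef_dd ?(ltnW jm) //; last first.
    by rewrite (leq_trans jm) // leq_addl.
  by rewrite bcoefE ifT //; lia.
rewrite /ladderX E -[dot (P n) _]dot_adj E adj_sum -big_split /=.
by apply: eq_bigr => j _; rewrite adjM adjK addrC.
Qed.

Lemma ladderX_calB n z : ladderX n.+1 z (P n) = \sum_(j < m.+1)
  (Delta P K j n.+1 z * (bcoef W P n (n.+1 + m - j - 1))^t*
   + bcoef W P n.+1 (n.+1 + m - j - 2) * star (Delta P K j n) z).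
Proof.
rewrite /ladderX big_split /=; congr (_ + _).
  rewrite (@dot_expand m.+1); last by rewrite addnS -addSn.
  apply: eq_bigr => j _; have jm := ltn_ord j; rewrite ltnS in jm.
  rewrite addnS -addSn coef_dd //; last by rewrite addSn ltnS (leq_trans jm) // leq_addl.
  by rewrite bcoefE ifT //; lia.
pose F j := bcoef W P n.+1 (n.+1 + m - j - 2) * star (Delta P K j n) z.
(* The divided difference of P_n K has degree below n + m, so against P_(n+1) its expansion needs
   only m - 1 terms. The terms with j >= m - 1 vanish because their [bcoef] index is below n + 1,
   even when it is truncated to 0. *)
rewrite (@sum_ord_trunc _ F m.-1); last 2 first.
- by rewrite (leq_trans (leq_pred _)).
- move=> j /andP[mj jm]; rewrite /F bcoefE ifF ?mul0r //.
  by apply/negbTE; rewrite -ltnNge; lia.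
rewrite -[LHS]dot_adj (@dot_expand m.-1); last first.
  by rewrite (leq_trans (size_dd _ _)) // addSn -addnS leq_add2l leqSpred.
rewrite adj_sum; apply: eq_bigr => j _; have jm := ltn_ord j.
have idx : (n.+1 + m.-1 - j - 1 = n + m - j - 1)%N by lia.
rewrite adjM adjK idx coef_dd; [|lia|lia].
rewrite /F bcoefE; have -> : (n.+1 + m - j - 2 = n + m - j - 1)%N by lia.
by rewrite ifT //; lia.
Qed.

Lemma star_calA n z : star (calA W P n K) z = - (ladderX n z (P n) * g n).
Proof.
rewrite /star /calA adjN mulmxE adjM gammacE g_adj ladderX_calA adj_sum.
congr (- (_ * _)); apply: eq_bigr => j _.
by rewrite adjD !adjM adjK /star conjCK adjK addrC.
Qed.

Lemma ladder_relation n z : peval (D (P n)) z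
  = - calB W P n K z *m peval (P n) z
    + star (calA W P n K) z *m betac W P n *m peval (Pprev P n) z.
Proof.
case: n => [|n].
  (* As P_0 = 1, the left side is K(z), which is minus [calB] at 0 by convention. *)
  rewrite /D P0_eq1 /= derivC mul0rn add0r mul1r opprK.
  by rewrite [peval 1 _]hornerC mulmxE mulr1 [peval 0 _]horner0 mulr0 addr0.
rewrite ladderE star_calA ladderX_calB /calB opprK gammacE mulmxE.
congr (_ + _); rewrite /betac !gammacE !mulmxE mulNr mulNr; congr (- (_ * _)).
(* The factor \gamma_(n+1) in A^* cancels the inverse in \beta_(n+1) and leaves the \gamma_n of
   [ladderE]. *)
rewrite -!mulrA; congr (_ * _); rewrite mulrA.
by rewrite [g n.+1 * _]divrr ?mul1r // unitrV.
Qed.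

Lemma peval_recurrence n z : z *: peval (P n) z
  = peval (P n.+1) z + alphac P n * peval (P n) z
    + betac W P n * peval (Pprev P n) z.
Proof.
rewrite -pevalMX; case: n => [|n].
  by rewrite recurrence0 pevalD pevalZ /= mul0r addr0.
have -> : betac W P n.+1 = be n.+1.
  by rewrite /betac !gammacE -[invmx _]/((g n.+1)^-1) mulmxE /g invrK.
by rewrite recurrence !pevalD !pevalZ.
Qed.

Lemma ladder_relation_next n z : peval (D (P n)) z
  = (star (calA W P n K) z *m (z%:M - alphac P n) - calB W P n K z)
      *m peval (P n) z
    - star (calA W P n K) z *m peval (P n.+1) z.
Proof.
rewrite ladder_relation !mulmxE -mulrA.
have -> : betac W P n * peval (Pprev P n) z
    = (z%:M - alphac P n) * peval (P n) z - peval (P n.+1) z.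
  rewrite mulrBl mul_scalarr peval_recurrence addrAC.
  rewrite -[_ + _ + betac _ _ _ * _]addrA [peval (P n.+1) z + _]addrC addrK.
  by rewrite addrAC subrr add0r.
by rewrite mulrBr !mulrA [in RHS]mulrBl mulNr addrA [- _ + _]addrC.
Qed.

End Ladder.

End OrthogonalPolynomials.

(** * Integration on the real line *)

Section RealLine.
Context {R : realType}.
Local Notation mu := (@lebesgue_measure R).

(** Otherwise |f| >= e on a set of infinite measure, and its integral would be infinite. *)
Lemma integrable_small (f : R -> R) (D : set R) (e : R) :
  measurable D -> mu D = +oo%E -> mu.-integrable setT (EFin \o f) ->
  0 < e -> exists x, D x /\ `|f x| < e.
Proof.
move=> mD Doo intf e0; apply: contrapT => /forallNP nf.
have ef x : D x -> e <= `|f x|.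
  by move=> Dx; rewrite leNgt; apply/negP => fx; exact: (nf x).
have intDf : mu.-integrable D (EFin \o f) by apply: integrableS intf.
have /integrableP[mf] := intDf; apply/negP; rewrite -leNgt.
have <- : (\int[mu]_(x in D) cst e%:E x = +oo)%E.
  transitivity (e%:E * mu D)%E; first exact: integral_cst.
  by rewrite Doo gt0_muley // lte_fin.
apply: ge0_le_integral => //.
- by move=> x _; rewrite lee_fin ltW.
- exact: measurable_int (integrable_abse intDf).
Qed.

(* Integrability of f provides endpoints a_n -> +oo and b_n -> -oo along which
   f tends to 0. *)
Lemma integral_derive_eq0 (f f' : R -> R) :
  (forall x : R, is_derive x (1 : R) f (f' x)) -> continuous f' ->
  mu.-integrable setT (EFin \o f) -> mu.-integrable setT (EFin \o f') ->
  \int[mu]_x (f' x) = 0.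
Proof.
move=> df cf' intf intf'.
have cf : continuous f.
  move=> x; apply/differentiable_continuous/derivable1_diffP.
  by have [] := df x.
have /choice[a an] n : exists x : R, n.+1%:R <= x /\ `|f x| < n.+1%:R^-1.
  have [||//||x [xn fx]] := integrable_small f [set` `[n.+1%:R, +oo[] n.+1%:R^-1.
  - exact: measurable_itv.
  - by rewrite lebesgue_measure_itv /= ltry.
  - by rewrite invr_gt0.
  - by exists x; move: xn; rewrite /= in_itv /= andbT.
have /choice[b bn] n : exists x : R, x <= - n.+1%:R /\ `|f x| < n.+1%:R^-1.
  have [||//||x [xn fx]] := integrable_small f [set` `]-oo, - n.+1%:R]] n.+1%:R^-1.
  - exact: measurable_itv.
  - by rewrite lebesgue_measure_itv /= ltNyr.
  - by rewrite invr_gt0.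
  - by exists x; move: xn; rewrite /= in_itv.
have ba n : b n < a n.
  have [[an1 _] [bn1 _]] := (an n, bn n).
  by rewrite (le_lt_trans bn1) // (lt_le_trans _ an1) // gtrN.
(* The truncations of f' to [b n, a n] converge pointwise to f' and are dominated by |f'|, while
   their integrals f(a n) - f(b n) tend to 0. *)
pose F n := (EFin \o f') \_ `[b n, a n].
have [_ _ cvgF] : [/\ mu.-integrable setT (EFin \o f'),
  [sequence (\int[mu]_x `|F n x - (f' x)%:E|)%E]_n @ \oo --> 0%E &
  [sequence (\int[mu]_x F n x)%E]_n @ \oo --> (\int[mu]_x (f' x)%:E)%E].
  apply: (@dominated_convergence _ _ _ mu setT _ F _ (abse \o (EFin \o f'))).
  - by [].
  - move=> n; have mi : measurable `[b n, a n]%classic by exact: measurable_itv.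
    apply/(measurable_restrictT (EFin \o f') mi).
    apply: measurable_funTS; exact: measurable_int intf'.
  - exact: measurable_int intf'.
  - apply/aeW => x _; apply: cvg_near_cst.
    near=> n; rewrite /F patchE ifT // inE /= in_itv /=.
    have xn : `|x| <= n.+1%:R.
      near: n; exists (Num.truncn `|x|) => // k /= kx.
      rewrite ltW // (lt_le_trans (truncnS_gt _)) // ler_nat.
      by rewrite ltnS.
    have [[an1 _] [bn1 _]] := (an n, bn n).
    by move: xn; rewrite ler_norml => /andP[h1 h2]; rewrite (le_trans bn1) // (le_trans h2).
  - exact: integrable_abse.
  - apply/aeW => x n _; rewrite /F patchE; case: ifP => // _ /=.
    by rewrite lee_fin normr0.
have FE n : (\int[mu]_x F n x = (f (a n) - f (b n))%:E)%E.
  rewrite -integral_mkcond (@continuous_FTC2 _ (f') f) //.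
  - exact: continuous_subspaceT.
  - split; first by move=> x _; have [] := df x.
    + exact/cvg_at_right_filter/cf.
    + exact/cvg_at_left_filter/cf.
  - by move=> x _; rewrite derive1E; have [_ ->] := df x.
have cvg0 : (\int[mu]_x F n x)%E @[n --> \oo] --> 0%E.
  rewrite (funext FE); apply: cvg_EFin; first exact: nearW.
  apply/cvgr0Pnorm_lt => e e0; near=> n.
  have [[_ an1] [_ bn1]] := (an n, bn n).
  rewrite /= (le_lt_trans (ler_normB _ _)) // (splitr e) ltrD //.
  - rewrite (lt_trans an1) //; near: n.
    exact: near_infty_natSinv_lt (PosNum (divr_gt0 e0 _)).
  - rewrite (lt_trans bn1) //; near: n.
    exact: near_infty_natSinv_lt (PosNum (divr_gt0 e0 _)).
by rewrite /Rintegral -(cvg_lim _ cvgF) // (cvg_lim _ cvg0).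
Unshelve. all: by end_near.
Qed.

End RealLine.

(** * Integrals of complex-valued and matrix-valued functions *)

Section ComplexIntegral.
Context {R : realType} {N : nat}.
Local Notation mu := (@lebesgue_measure R).
Local Notation C := R[i].
Local Notation M := 'M[R[i]]_N.+1.

Definition cintegrable (f : R -> C) : Prop :=
  mu.-integrable setT (EFin \o (fun x => complex.Re (f x))) /\
  mu.-integrable setT (EFin \o (fun x => complex.Im (f x))).

Definition cint (f : R -> C) : C :=
  Rintegral mu setT (fun x => complex.Re (f x))
  +i* Rintegral mu setT (fun x => complex.Im (f x)).

Lemma cintegrableD f g :
  cintegrable f -> cintegrable g -> cintegrable (fun x => f x + g x).
Proof.
move=> [fr fi] [gr gi]; split.
- rewrite (_ : _ \o _ = fun x => (complex.Re (f x))%:E + (complex.Re (g x))%:E)%E.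
    exact: integrableD.
  by apply/funext => x /=; case: (f x) (g x) => ? ? [].
- rewrite (_ : _ \o _ = fun x => (complex.Im (f x))%:E + (complex.Im (g x))%:E)%E.
    exact: integrableD.
  by apply/funext => x /=; case: (f x) (g x) => ? ? [].
Qed.

Lemma integrable_lin (f g : R -> R) (a b : R) :
  mu.-integrable setT (EFin \o f) -> mu.-integrable setT (EFin \o g) ->
  mu.-integrable setT (EFin \o (fun x => a * f x + b * g x)).
Proof.
move=> fi gi.
rewrite (_ : _ \o _ = fun x => a%:E * (f x)%:E + b%:E * (g x)%:E)%E //.
by apply: integrableD => //; apply: integrableZl.
Qed.

Lemma Rintegral_lin (f g : R -> R) (a b : R) :
  mu.-integrable setT (EFin \o f) -> mu.-integrable setT (EFin \o g) ->
  Rintegral mu setT (fun x => a * f x + b * g x)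
  = a * Rintegral mu setT f + b * Rintegral mu setT g.
Proof.
move=> fi gi; rewrite RintegralD //.
- by rewrite !RintegralZl.
- by rewrite (_ : _ \o _ = fun x => a%:E * (f x)%:E)%E //; apply: integrableZl.
- by rewrite (_ : _ \o _ = fun x => b%:E * (g x)%:E)%E //; apply: integrableZl.
Qed.

Lemma complex_ReM (c d : C) : complex.Re (c * d)
  = complex.Re c * complex.Re d + (- complex.Im c) * complex.Im d.
Proof. by case: c d => ? ? [? ?] /=; rewrite mulNr. Qed.

Lemma complex_ImM (c d : C) : complex.Im (c * d)
  = complex.Im c * complex.Re d + complex.Re c * complex.Im d.
Proof. by case: c d => ? ? [? ?] /=; rewrite addrC. Qed.

Lemma cintegrableZ c f : cintegrable f -> cintegrable (fun x => c * f x).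
Proof.
move=> [fr fi]; split.
- rewrite (funext (fun x => complex_ReM c (f x))); exact: integrable_lin.
- rewrite (funext (fun x => complex_ImM c (f x))); exact: integrable_lin.
Qed.

Lemma cintegrable0 : cintegrable (fun=> 0).
Proof. by split; exact: integrable0. Qed.

Lemma cintegrable_sum n (F : 'I_n -> R -> C) :
  (forall i, cintegrable (F i)) -> cintegrable (fun x => \sum_i F i x).
Proof.
elim: n F => [|n IHn] F hF.
  by under eq_fun do rewrite big_ord0; exact: cintegrable0.
under eq_fun do rewrite big_ord_recl.
by apply: cintegrableD => //; exact: IHn.
Qed.

Lemma cintegrable_conj f :
  cintegrable f -> cintegrable (fun x => Num.conj (f x)).
Proof.
move=> [fr fi]; split.
  rewrite (_ : (fun x => complex.Re _) = fun x => complex.Re (f x)) //.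
  by apply/funext => x; case: (f x).
rewrite (_ : (fun x => complex.Im _) = fun x => 0 * complex.Re (f x) + (-1) * complex.Im (f x)).
  exact: integrable_lin.
by apply/funext => x; case: (f x) => a b /=; rewrite mul0r add0r mulN1r.
Qed.

Lemma cintD f g : cintegrable f -> cintegrable g ->
  cint (fun x => f x + g x) = cint f + cint g.
Proof.
move=> [fr fi] [gr gi]; rewrite /cint.
apply/eqP; rewrite eq_complex /= -!RintegralD //; apply/andP; split; apply/eqP.
- by apply: eq_Rintegral => x _; case: (f x) (g x) => ? ? [].
- by apply: eq_Rintegral => x _; case: (f x) (g x) => ? ? [].
Qed.

Lemma cintZ c f : cintegrable f -> cint (fun x => c * f x) = c * cint f.
Proof.
move=> [fr fi]; apply/eqP; rewrite eq_complex complex_ReM complex_ImM /= -!Rintegral_lin //.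
by apply/andP; split; apply/eqP; apply: eq_Rintegral => x _; rewrite ?complex_ReM ?complex_ImM.
Qed.

Lemma cint0 : cint (fun=> 0) = 0.
Proof. by rewrite -(mul0r (0 : C)) cintZ ?mul0r //; exact: cintegrable0. Qed.

Lemma cint_sum n (F : 'I_n -> R -> C) : (forall i, cintegrable (F i)) ->
  cint (fun x => \sum_i F i x) = \sum_i cint (F i).
Proof.
elim: n F => [|n IHn] F hF.
  by under eq_fun do rewrite big_ord0; rewrite big_ord0 cint0.
under eq_fun do rewrite big_ord_recl.
by rewrite cintD ?IHn ?big_ord_recl //; exact: cintegrable_sum.
Qed.

Lemma cint_conj f : cintegrable f ->
  cint (fun x => Num.conj (f x)) = Num.conj (cint f).
Proof.
move=> [fr fi]; apply/eqP; rewrite eq_complex /=; apply/andP; split; apply/eqP.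
  by apply: eq_Rintegral => x _; case: (f x).
rewrite -mulN1r -RintegralZl //.
by apply: eq_Rintegral => x _; case: (f x) => a b /=; rewrite mulN1r.
Qed.

Lemma cint_real (f : R -> R) : cint (fun x => (f x)%:C) = (Rintegral mu setT f)%:C.
Proof.
by rewrite /cint /=; apply/eqP; rewrite eq_complex /= eqxx /Rintegral integral0 eqxx.
Qed.

Definition mxintegrable (F : R -> M) : Prop :=
  forall i j, cintegrable (fun x => F x i j).

Implicit Types (A : M) (F G : R -> M).

Lemma mxintE F i j : mxint F i j = cint (fun x => F x i j).
Proof. by rewrite mxE. Qed.

Lemma mxintegrableD F G :
  mxintegrable F -> mxintegrable G -> mxintegrable (fun x => F x + G x).
Proof.
move=> hF hG i j; under eq_fun do rewrite mxE; exact: cintegrableD.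
Qed.

Lemma mxintegrableMl A F : mxintegrable F -> mxintegrable (fun x => A * F x).
Proof.
move=> hF i j; under eq_fun do rewrite mxE.
by apply: cintegrable_sum => k; exact: cintegrableZ.
Qed.

Lemma mxintegrable_adj F : mxintegrable F -> mxintegrable (fun x => (F x)^t*).
Proof.
by move=> hF i j; under eq_fun do rewrite !mxE; exact: cintegrable_conj.
Qed.

Lemma mxintD F G : mxintegrable F -> mxintegrable G ->
  mxint (fun x => F x + G x) = mxint F + mxint G.
Proof.
move=> hF hG; apply/matrixP => i j; rewrite [RHS]mxE !mxintE -cintD //.
by under eq_fun do rewrite mxE.
Qed.

Lemma mxintMl A F : mxintegrable F -> mxint (fun x => A * F x) = A * mxint F.
Proof.
move=> hF; apply/matrixP => i j; rewrite [RHS]mxE [LHS]mxintE.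
under eq_fun do rewrite mxE.
rewrite cint_sum => [|k]; last exact: cintegrableZ.
by apply: eq_bigr => k _; rewrite cintZ //; congr (_ * _); rewrite mxintE.
Qed.

Lemma mxint_adj F : mxintegrable F -> mxint (fun x => (F x)^t*) = (mxint F)^t*.
Proof.
move=> hF; apply/matrixP => i j.
rewrite [RHS]mxE [X in Num.conj X]mxE !mxintE -cint_conj //.
by under eq_fun do rewrite !mxE.
Qed.

Lemma mxintMr A F : mxintegrable F -> mxint (fun x => F x * A) = mxint F * A.
Proof.
move=> hF; rewrite -[RHS]adjK adjM -mxint_adj // -mxintMl; last first.
  exact: mxintegrable_adj.
rewrite -mxint_adj; last by apply: mxintegrableMl; exact: mxintegrable_adj.
by congr mxint; apply/funext => x; rewrite adjM !adjK.
Qed.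

End ComplexIntegral.

Lemma conj_complexR (R : rcfType) (x : R) : Num.conj (x%:C : R[i]) = x%:C.
Proof. by apply/eqP; rewrite eq_complex /= oppr0 !eqxx. Qed.

(** * The weighted form *)

Section SesquilinearDerivative.
Context {C : numClosedFieldType} {N : nat}.
Local Notation M := 'M[C]_N.+1.
Implicit Types (A : M) (p q s : {poly M}).
Variables f f' : {poly M} -> {poly M} -> M.
Hypothesis fDl : forall p q s, f (p + q) s = f p s + f q s.
Hypothesis fDr : forall p q s, f s (p + q) = f s p + f s q.
Hypothesis fZl : forall A p q, f (A *: p) q = A * f p q.
Hypothesis fZr : forall A p q, f p (A *: q) = f p q * A^t*.
Hypothesis fMX : forall p q, f (p * 'X) q = f p (q * 'X).
Hypothesis f'Dl : forall p q s, f' (p + q) s = f' p s + f' q s.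
Hypothesis f'Dr : forall p q s, f' s (p + q) = f' s p + f' s q.
Hypothesis f'Zl : forall A p q, f' (A *: p) q = A * f' p q.
Hypothesis f'Zr : forall A p q, f' p (A *: q) = f' p q * A^t*.
Hypothesis f'MX : forall p q, f' (p * 'X) q = f' p (q * 'X).

(** An integration by parts that only needs checking on monomials: f' stands for the form of the
    differentiated weight. Induction on p moves each X to the second slot, which reduces p to a
    constant; then linearity in q reduces to powers of X. *)
Lemma sesquilinear_derivative p q :
  (forall k, f' 1 'X^k + f 1 ('X^k)^`() = 0) ->
  f p^`() q + f' p q + f p q^`() = 0.
Proof.
have f0l r : f 0 r = 0 by rewrite -[0 in LHS](scale0r (1 : {poly M})) fZl mul0r.
have f'0l r : f' 0 r = 0 by rewrite -[0 in LHS](scale0r (1 : {poly M})) f'Zl mul0r.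
have f0r r : f r 0 = 0 by rewrite -[0 in LHS](scale0r (1 : {poly M})) fZr adj0 mulr0.
have f'0r r : f' r 0 = 0 by rewrite -[0 in LHS](scale0r (1 : {poly M})) f'Zr adj0 mulr0.
move=> f0; elim/poly_ind: p q => [|p A IHp] q.
  by rewrite deriv0 !f0l f'0l !addr0.
rewrite derivD derivC addr0 derivM derivX mulr1 !fDl f'Dl fMX f'MX [f (p * 'X) _]fMX.
(* The first group becomes the induction hypothesis for p and q X once f p q is absorbed into the
   derivative of q X; the second collects the terms in the constant A. *)
rewrite (AC (2*2*2) ((1*3*(5*2))*(4*6))) /=.
have -> : f p (q^`() * 'X) + f p q = f p (q * 'X)^`().
  by rewrite derivM derivX mulr1 fDr.
rewrite IHp add0r -alg_polyC fZl f'Zl -mulrDr.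
suff -> : f' 1 q + f 1 q^`() = 0 by rewrite mulr0.
rewrite -[q]coefK poly_def; elim/big_rec: _ => [|k r _ IHr].
  by rewrite deriv0 f'0r f0r addr0.
by rewrite derivD derivZ f'Dr fDr addrACA IHr addr0 f'Zr fZr -mulrDl f0 mul0r.
Qed.

End SesquilinearDerivative.

Section WeightedForm.
Context {R : realType} {N : nat}.
Local Notation mu := (@lebesgue_measure R).
Local Notation C := R[i].
Local Notation M := 'M[R[i]]_N.+1.
Implicit Types (A : M) (F V : R -> M) (p q s : {poly M}).

Definition moments F : Prop :=
  forall k : nat, mxintegrable (fun x => (x%:C ^+ k)%:M * F x).

Lemma momentsW F : moments F -> mxintegrable F.
Proof. by move=> /(_ 0%N); under eq_fun do rewrite expr0 mul1r. Qed.

Lemma momentsD F V : moments F -> moments V -> moments (fun x => F x + V x).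
Proof.
by move=> hF hV k; under eq_fun do rewrite mulrDr; exact: mxintegrableD.
Qed.

Lemma momentsMl A F : moments F -> moments (fun x => A * F x).
Proof.
move=> hF k.
have -> : (fun x => (x%:C ^+ k)%:M * (A * F x)) = fun x => A * ((x%:C ^+ k)%:M * F x).
  by apply/funext => x; rewrite !mulrA mul_scalarr mulr_scalar.
exact: mxintegrableMl.
Qed.

Lemma momentsX F : moments F -> moments (fun x => x%:C%:M * F x).
Proof.
move=> hF k.
have -> : (fun x => (x%:C ^+ k)%:M * (x%:C%:M * F x)) = fun x => (x%:C ^+ k.+1)%:M * F x.
  by apply/funext => x; rewrite mulrA exprSr scalar_mxM.
exact: hF.
Qed.

Lemma moments0 : moments (fun=> 0).
Proof.
move=> k i j; under eq_fun do rewrite mulr0 mxE; exact: cintegrable0.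
Qed.

Lemma moments_adj F : moments F -> moments (fun x => (F x)^t*).
Proof.
move=> hF k.
have -> : (fun x => (x%:C ^+ k)%:M * (F x)^t*) = fun x => ((x%:C ^+ k)%:M * F x)^t*.
  apply/funext => x; rewrite adjM adj_scalar mul_scalarr mulr_scalar.
  by rewrite rmorphXn /= conj_complexR.
exact: mxintegrable_adj.
Qed.

Lemma moments_peval p F : moments F -> moments (fun x => peval p x%:C * F x).
Proof.
move=> hF; elim/poly_ind: p => [|p A IHp].
  under eq_fun do rewrite /peval horner0 mul0r; exact: moments0.
have -> : (fun x => peval (p * 'X + A%:P) x%:C * F x)
    = fun x => x%:C%:M * (peval p x%:C * F x) + A * F x.
  apply/funext => x; rewrite pevalD pevalMX [peval A%:P _]hornerC mulrDl.
  by rewrite mul_scalarr -scalerAl.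
by apply: momentsD; [exact: momentsX | exact: momentsMl].
Qed.

(** [wdot] for a complex matrix weight that need be neither real nor Hermitian: besides W, the
    products G W and W G^* occur separately as weights. *)
Definition form V p q : M :=
  mxint (fun x => peval p x%:C * V x * (peval q x%:C)^t*).

(** [moments_peval] puts polynomials on the left; the right factor is reached by taking adjoints
    before and after a second use of it. *)
Lemma form_integrable V p q : moments V ->
  mxintegrable (fun x => peval p x%:C * V x * (peval q x%:C)^t*).
Proof.
move=> hV; have := moments_adj _ (moments_peval q _ (moments_adj _ (moments_peval p _ hV))).
move=> /momentsW; congr mxintegrable; apply/funext => x.
by rewrite adjM adjK.
Qed.

Lemma formDl V p q s : moments V -> form V (p + q) s = form V p s + form V q s.
Proof.
move=> hV; rewrite -mxintD; try exact: form_integrable.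
by congr mxint; apply/funext => x; rewrite pevalD !mulrDl.
Qed.

Lemma formZl V A p q : moments V -> form V (A *: p) q = A * form V p q.
Proof.
move=> hV; rewrite -mxintMl; last exact: form_integrable.
by congr mxint; apply/funext => x; rewrite pevalZ !mulrA.
Qed.

Lemma formMX V p q : form V (p * 'X) q = form V p (q * 'X).
Proof.
congr mxint; apply/funext => x; rewrite !pevalMX adjZ -!scalerAl -scalerAr.
by rewrite conj_complexR.
Qed.

Lemma form_adj V p q : moments V ->
  (form V p q)^t* = form (fun x => (V x)^t*) q p.
Proof.
move=> hV; rewrite -mxint_adj; last exact: form_integrable.
by congr mxint; apply/funext => x; rewrite !adjM adjK mulrA.
Qed.

Lemma formZr V A p q : moments V -> form V p (A *: q) = form V p q * A^t*.
Proof.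
move=> hV; rewrite -mxintMr; last exact: form_integrable.
by congr mxint; apply/funext => x; rewrite pevalZ adjM !mulrA.
Qed.

Lemma formDr V p q s : moments V -> form V p (q + s) = form V p q + form V p s.
Proof.
move=> hV; rewrite -mxintD; try exact: form_integrable.
by congr mxint; apply/funext => x; rewrite pevalD adjD !mulrDr.
Qed.

Lemma form_weightD V V' p q : moments V -> moments V' ->
  form (fun x => V x + V' x) p q = form V p q + form V' p q.
Proof.
move=> hV hV'; rewrite -mxintD; try exact: form_integrable.
by congr mxint; apply/funext => x; rewrite mulrDr mulrDl.
Qed.

Lemma form_weightMl V K p q : form V (p * K) q
  = form (fun x => peval K x%:C * V x) p q.
Proof.
congr mxint; apply/funext => x; rewrite !mulrA; congr (_ * _ * _).
rewrite /peval hornerM_comm //.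
by rewrite /comm_poly mulr_scalar mul_scalarr.
Qed.

Lemma form_weightMr V K p q : form V p (q * K)
  = form (fun x => V x * (peval K x%:C)^t*) p q.
Proof.
congr mxint; apply/funext => x; rewrite -!mulrA -adjM; congr (_ * (_ * _^t*)).
rewrite /peval hornerM_comm //.
by rewrite /comm_poly mulr_scalar mul_scalarr.
Qed.

Lemma form_weight0 p q : form (fun=> 0) p q = 0.
Proof.
apply/matrixP => i j; rewrite mxintE mxE -[RHS]cint0; congr cint.
by apply/funext => x; rewrite mulr0 mul0r mxE.
Qed.

Lemma form_skew_derivative V V' p q : moments V -> moments V' ->
  (forall k, form V' 1 'X^k + form V 1 ('X^k)^`() = 0) ->
  form V p^`() q + form V' p q + form V p q^`() = 0.
Proof.
move=> hV hV' V0.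
exact: (sesquilinear_derivative (form V) (form V')
  (fun p q s => formDl V p q s hV) (fun p q s => formDr V s p q hV)
  (fun A p q => formZl V A p q hV) (fun A p q => formZr V A p q hV)
  (formMX V)
  (fun p q s => formDl V' p q s hV') (fun p q s => formDr V' s p q hV')
  (fun A p q => formZl V' A p q hV') (fun A p q => formZr V' A p q hV')
  (formMX V') p q V0).
Qed.

End WeightedForm.

Lemma complex_ReD (R : rcfType) (c d : R[i]) :
  complex.Re (c + d) = complex.Re c + complex.Re d.
Proof. by case: c d => ? ? []. Qed.

Lemma complex_ImD (R : rcfType) (c d : R[i]) :
  complex.Im (c + d) = complex.Im c + complex.Im d.
Proof. by case: c d => ? ? []. Qed.

(** * Derivative of the weight *)

Section RealDerivative.
Context {R : realType}.
Implicit Types (f g : R -> R) (x a b : R).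

Lemma is_derive_ext f g x a b : is_derive x (1 : R) f a ->
  f =1 g -> a = b -> is_derive x (1 : R) g b.
Proof. by move=> fa /funext <- <-. Qed.

Lemma is_derive_add f g x a b : is_derive x (1 : R) f a ->
  is_derive x (1 : R) g b -> is_derive x (1 : R) (fun y => f y + g y) (a + b).
Proof. by move=> fa gb; exact: is_deriveD. Qed.

Lemma is_derive_opp f x a : is_derive x (1 : R) f a ->
  is_derive x (1 : R) (fun y => - f y) (- a).
Proof. by move=> fa; exact: is_deriveN. Qed.

Lemma is_derive_mul f g x a b : is_derive x (1 : R) f a ->
  is_derive x (1 : R) g b ->
  is_derive x (1 : R) (fun y => f y * g y) (a * g x + f x * b).
Proof.
move=> fa gb; apply: (is_derive_ext (f * g) _ _ _ _ (is_deriveM fa gb)) => //.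
transitivity (f x * b + g x * a) => //.
by rewrite addrC [g x * a]mulrC.
Qed.

Lemma is_derive_unique f x a b : is_derive x (1 : R) f a ->
  is_derive x (1 : R) f b -> a = b.
Proof. by move=> [_ <-] [_ <-]. Qed.

Lemma is_derive_entry m n (F : R -> 'M[R]_(m.+1, n.+1)) x i j :
  derivable F x 1 -> is_derive x (1 : R) (fun y => F y i j) (derive1 F x i j).
Proof.
move=> dF; apply: DeriveDef; first exact: (derivable_mxP _ _ _).1 dF i j.
by rewrite derive1E (derive_mx dF) mxE.
Qed.

End RealDerivative.

Section Weight.
Context {R : realType} {N : nat}.
Local Notation mu := (@lebesgue_measure R).
Local Notation C := R[i].
Local Notation M := 'M[R[i]]_N.+1.

Lemma finite_moments_moments (F : R -> 'M[R]_N.+1) :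
  finite_moments F -> moments (fun x => mxC (F x)).
Proof.
move=> hF k i j.
have -> : (fun x => ((x%:C ^+ k)%:M * mxC (F x)) i j)
    = fun x => (x ^+ k * F x i j)%:C.
  by apply/funext => x; rewrite mul_scalarr !mxE -rmorphXn -rmorphM.
split; first exact: hF.
rewrite (_ : _ \o _ = fun=> 0%E) //; exact: integrable0.
Qed.

Lemma peval_Xn k (z : C) : peval ('X^k : {poly M}) z = (z ^+ k)%:M.
Proof.
elim: k => [|k IHk]; first by rewrite expr0 [peval 1 _]hornerC expr0.
by rewrite exprSr pevalMX IHk exprS -scale_scalar_mx.
Qed.

Lemma mxC_adj (A : 'M[R]_N.+1) : (mxC A)^t* = mxC A^T.
Proof. by apply/matrixP => i j; rewrite !mxE conj_complexR. Qed.

Variable W : R -> 'M[R]_N.+1.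
Hypothesis hW : is_weight W.

Lemma weight_is_derive i j x :
  is_derive x (1 : R) (fun y => W y i j) (derive1 W x i j).
Proof.
by have [/(_ 0%N x) dW _ _ _] := hW; exact: is_derive_entry.
Qed.

Lemma weight_derive_continuous i j : continuous (fun x => derive1 W x i j).
Proof.
have [sW _ _ _] := hW; move=> x.
apply/differentiable_continuous/derivable1_diffP.
by apply: (derivable_mxP (derive1 W) x 1).1; exact: (sW 1%N x).
Qed.

(** The integrand is the derivative of x^k W_ij, which is integrable with integrable derivative, so
    [integral_derive_eq0] applies. For k = 0 the truncated exponent is harmless, as its term is
    multiplied by 0. *)
Lemma weight_moment_derivative k i j :
  Rintegral mu setT (fun x => x ^+ k * derive1 W x i j)
  + Rintegral mu setT (fun x => x ^+ k.-1 * W x i j) *+ k = 0.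
Proof.
have [_ _ mW mW'] := hW.
have := @integral_derive_eq0 R (fun x => x ^+ k * W x i j)
  (* The factor 1 gives the derivative the shape of a linear combination for [Rintegral_lin]. *)
  (fun x => 1 * (x ^+ k * derive1 W x i j) + k%:R * (x ^+ k.-1 * W x i j)).
rewrite Rintegral_lin ?mul1r ?mulr_natl; [|exact: mW'|exact: mW].
apply.
- move=> x; have dW := weight_is_derive i j x.
  have dX : is_derive x (1 : R) (fun y : R => y ^+ k) (x ^+ k.-1 *+ k).
    have := is_derive_poly ('X^k : {poly R}) x.
    rewrite derivXn hornerMn hornerXn.
    by congr is_derive; apply/funext => y; rewrite hornerXn.
  apply: (@is_derive_eq _ _ _ _ _ _ _ _ (is_deriveM dX dW)).
  transitivity (x ^+ k * derive1 W x i j + W x i j * (x ^+ k.-1 *+ k)) => //.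
  by rewrite mul1r -mulr_natl mulrCA [W x i j * _]mulrC.
- move=> x; apply: cvgD; (apply: cvgM; first exact: cvg_cst).
    by apply: cvgM; [exact: exprn_continuous | exact: weight_derive_continuous].
  apply: cvgM; first exact: exprn_continuous.
  apply/differentiable_continuous/derivable1_diffP.
  by have [] := weight_is_derive i j x.
- exact: mW.
- apply: integrable_lin; [exact: mW'|exact: mW].
Qed.

Lemma form_weight_derivative k :
  form (fun x => mxC (derive1 W x)) 1 'X^k
  + form (fun x => mxC (W x)) 1 ('X^k)^`() = 0.
Proof.
have [_ _ mW mW'] := hW.
have formE (F : R -> 'M[R]_N.+1) l : form (fun x => mxC (F x)) 1 'X^l
    = \matrix_(i, j) (Rintegral mu setT (fun x => x ^+ l * F x i j))%:C.
  apply/matrixP => i j; rewrite mxintE mxE -cint_real; congr cint.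
  apply/funext => x; rewrite [peval 1 _]hornerC mul1r.
  rewrite peval_Xn adj_scalar mulr_scalar !mxE rmorphXn /= conj_complexR.
  by rewrite -rmorphXn -rmorphM.
rewrite derivXn -scaler_nat formZr; last exact: finite_moments_moments.
have -> : (k%:R : M)^t* = k%:R 
  by elim: (k) => [|l IHl]; rewrite ?adj0 // mulrSr adjD IHl adj1.
rewrite !formE mulr_natr; apply/matrixP => i j; rewrite !mxE mulmxnE mxE.
by rewrite -rmorphMn -rmorphD weight_moment_derivative.
Qed.

Lemma weight_adj x : (mxC (W x))^t* = mxC (W x).
Proof. by have [_ /(_ x) [WT _] _ _] := hW; rewrite mxC_adj WT. Qed.

Lemma weight_unit x : W x \in unitmx.
Proof.
have [_ /(_ x) [WT Wpos] _ _] := hW.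
rewrite -row_free_unit -kermx_eq0; apply/rowV0P => v /sub_kermxP vW.
apply/eqP; apply: contraT => v0.
have := Wpos v^T; rewrite trmx_eq0 trmxK vW mul0mx mxE ltxx.
by move=> /(_ v0).
Qed.

Section Factor.
Variables (T : R -> M) (G : {poly M}).
Hypothesis hT : csmooth T.
Hypothesis hTG : forall x : R, cderive1 T x = peval G x%:C *m T x.
Hypothesis hWT : forall x : R, mxC (W x) = T x *m (T x)^t*.

Lemma factor_unit x : T x \in unitmx.
Proof.
have : mxC (W x) \in unitmx by rewrite map_unitmx weight_unit.
by rewrite hWT unitmx_mul => /andP[].
Qed.

(** Differentiation of a complex function of a real variable through its real and imaginary parts,
    matching [cderive1]. *)
Let cis_derive (f : R -> C) (x : R) (d : C) : Prop :=
  is_derive x (1 : R) (fun y => complex.Re (f y)) (complex.Re d) /\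
  is_derive x (1 : R) (fun y => complex.Im (f y)) (complex.Im d).

Let cis_derive0 x : cis_derive (fun=> 0) x 0.
Proof. by split; exact: is_derive_cst. Qed.

Let cis_deriveD f g x d e : cis_derive f x d -> cis_derive g x e ->
  cis_derive (fun y => f y + g y) x (d + e).
Proof.
move=> [fr fi] [gr gi]; split.
- apply: (is_derive_ext _ _ _ _ _ (is_derive_add _ _ _ _ _ fr gr)) => [y|];
    by rewrite raddfD.
- apply: (is_derive_ext _ _ _ _ _ (is_derive_add _ _ _ _ _ fi gi)) => [y|];
    by rewrite raddfD.
Qed.

Let cis_derive_conj f x d : cis_derive f x d ->
  cis_derive (fun y => Num.conj (f y)) x (Num.conj d).
Proof.
move=> [fr fi]; split.
- by apply: (is_derive_ext _ _ _ _ _ fr) => [y|]; [case: (f y) | case: d {fr fi}].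
- apply: (is_derive_ext _ _ _ _ _ (is_derive_opp _ _ _ fi)) => [y|].
    by case: (f y).
  by case: d {fr fi}.
Qed.

Let cis_deriveM f g x d e : cis_derive f x d -> cis_derive g x e ->
  cis_derive (fun y => f y * g y) x (d * g x + f x * e).
Proof.
move=> [fr fi] [gr gi]; split.
- apply: (is_derive_ext _ _ _ _ _ (is_derive_add _ _ _ _ _
    (is_derive_mul _ _ _ _ _ fr gr)
    (is_derive_opp _ _ _ (is_derive_mul _ _ _ _ _ fi gi)))) => [y|].
    by rewrite complex_ReM mulNr.
  by rewrite complex_ReD !complex_ReM; ring.
- apply: (is_derive_ext _ _ _ _ _ (is_derive_add _ _ _ _ _
    (is_derive_mul _ _ _ _ _ fi gr) (is_derive_mul _ _ _ _ _ fr gi))) => [y|].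
    by rewrite complex_ImM.
  by rewrite complex_ImD !complex_ImM; ring.
Qed.

Let cis_derive_sum n (f : 'I_n -> R -> C) x (d : 'I_n -> C) :
  (forall k, cis_derive (f k) x (d k)) ->
  cis_derive (fun y => \sum_k f k y) x (\sum_k d k).
Proof.
elim: n f d => [|n IHn] f d fd.
  under eq_fun do rewrite big_ord0.
  by rewrite big_ord0; exact: cis_derive0.
under eq_fun do rewrite big_ord_recl.
rewrite big_ord_recl; apply: cis_deriveD; first exact: fd.
by apply: IHn => k; exact: fd.
Qed.

Let factor_cis_derive i j x :
  cis_derive (fun y => T y i j) x ((peval G x%:C *m T x) i j).
Proof.
have dr : derivable (fun y => mxRe (T y)) x 1 by case: hT => /(_ 0%N x).
have di : derivable (fun y => mxIm (T y)) x 1 by case: hT => _ /(_ 0%N x).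
rewrite -hTG mxE; split.
- apply: (is_derive_ext _ _ _ _ _ (is_derive_entry _ _ _ _ i j dr)) => // y.
  by rewrite mxE.
- apply: (is_derive_ext _ _ _ _ _ (is_derive_entry _ _ _ _ i j di)) => // y.
  by rewrite mxE.
Qed.

(** The product rule for W = T T^* with T' = G T, entry by entry, compared with the derivative of
    the real matrix W. *)
Lemma weight_derivativeE x :
  peval G x%:C * mxC (W x) + mxC (W x) * (peval G x%:C)^t* = mxC (derive1 W x).
Proof.
apply/matrixP => i j; rewrite [RHS]mxE.
have dW : cis_derive (fun y => mxC (W y) i j) x
    ((peval G x%:C * mxC (W x) + mxC (W x) * (peval G x%:C)^t*) i j).
  have -> : (fun y => mxC (W y) i j)
      = fun y => \sum_k T y i k * Num.conj (T y j k).
    by apply/funext => y; rewrite hWT mxE; apply: eq_bigr => k _; rewrite !mxE.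
  have -> : (peval G x%:C * mxC (W x) + mxC (W x) * (peval G x%:C)^t*) i j
      = \sum_k ((peval G x%:C *m T x) i k * Num.conj (T x j k)
          + T x i k * Num.conj ((peval G x%:C *m T x) j k)).
    rewrite hWT mulmxE mulrA -[X in _ + X]mulrA -adjM mxE big_split /=.
    by rewrite !mxE; congr (_ + _); apply: eq_bigr => k _; rewrite !mxE.
  apply: cis_derive_sum => k; apply: cis_deriveM; first exact: factor_cis_derive.
  exact/cis_derive_conj/factor_cis_derive.
have [dr di] := dW.
apply/eqP; rewrite eq_complex; apply/andP; split; apply/eqP.
- apply: is_derive_unique dr _.
  (* The real part is the entry of W itself; the imaginary part, treated next, is identically 0. *)
  by apply: (is_derive_ext _ _ _ _ _ (weight_is_derive i j x)) => // y; rewrite mxE.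
- apply: is_derive_unique di _.
  by apply: (is_derive_ext _ _ _ _ _ (is_derive_cst 0 x 1)) => // y; rewrite mxE.
Qed.

End Factor.

End Weight.

(** * Nondegeneracy of the Gram matrices *)

Section Gram.
Context {R : realType} {N : nat}.
Local Notation mu := (@lebesgue_measure R).
Local Notation C := R[i].
Local Notation M := 'M[R[i]]_N.+1.

(** A nonnegative function with integral 0 vanishes almost everywhere. If no zero lay outside Z, a
    null set together with Z would cover the line, which has infinite measure. *)
Lemma zero_off_countable (f : R -> R) (Z : set R) :
  mu.-integrable setT (EFin \o f) -> (forall x, 0 <= f x) ->
  Rintegral mu setT f = 0 -> countable Z -> exists x, ~ Z x /\ f x = 0.
Proof.
move=> intf f0 If cZ; apply: contrapT => /forallNP nf.
have fae : (\int[mu]_x `|(EFin \o f) x|)%E = 0%E.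
  have -> : (fun x => `|(EFin \o f) x|%E) = (fun x => (f x)%:E).
    by apply/funext => x /=; rewrite ger0_norm.
  have fin := integrable_fin_num measurableT intf.
  by rewrite -[LHS]fineK // -/(Rintegral mu setT f) If.
have mf := measurable_int _ intf.
have [A [mA A0 sA]] := (ae_eq_integral_abs _ measurableT mf).1 fae.
have nT : mu.-negligible [set: R].
  apply: (@negligibleS _ _ _ _ (A `|` Z)).
    move=> x _; case: (pselect (Z x)) => [|nZx]; first by right.
    left; apply: sA => /= /(_ I) fx0.
    apply: (nf x); split => //; exact: EFin_inj.
  apply: negligibleU; first by exists A; split.
  exists Z; split => //.
    exact: countable_measurable.
  exact: countable_lebesgue_measure0.
have muT : mu [set: R] = +oo%E by rewrite -set_itvNyy lebesgue_measure_itv.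
have : mu [set: R] = 0%E by exact: measure_negligible.
by rewrite muT.
Qed.

Lemma countable_roots (q : {poly C}) : q != 0 ->
  countable [set x : R | root q x%:C].
Proof.
move=> q0; have [rs qE] := closed_field_poly_normal q.
apply: finite_set_countable.
apply: (@sub_finite_set _ _ ((@complex.Re R) @` [set` rs])).
  move=> x /=; rewrite qE rootZ ?lead_coef_eq0 // root_prod_XsubC => xr.
  by exists x%:C.
by apply: finite_image; exact: finite_seq.
Qed.

(** An entry of v p(z) is a scalar polynomial in z, so finiteness of roots becomes available. *)
Lemma horner_row (p : {poly M}) (v : 'rV[C]_N.+1) i z :
  (\poly_(k < size p) (v *m p`_k) 0 i).[z] = (v *m peval p z) 0 i.
Proof.
rewrite horner_poly /peval horner_coef mulmx_sumr summxE; apply: eq_bigr => k _.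
have -> : (z%:M : M) ^+ k = (z ^+ k)%:M by rewrite rmorphXn.
by rewrite mulr_scalar -scalemxAr [RHS]mxE mulrC.
Qed.

Lemma adj_conj_entry (A B : M) i :
  (A * B * A^t*) i i = (row i A *m B *m (row i A)^t*) 0 0.
Proof.
by rewrite -row_mul [LHS]mxE [RHS]mxE; apply: eq_bigr => k _; rewrite !mxE.
Qed.

Variables (W : R -> 'M[R]_N.+1) (T : R -> M).
Hypothesis hW : is_weight W.
Hypothesis hWT : forall x : R, mxC (W x) = T x *m (T x)^t*.

Lemma weight_quad x (u : 'rV[C]_N.+1) :
  (u *m mxC (W x) *m u^t*) 0 0 = \sum_k `|(u *m T x) 0 k| ^+ 2.
Proof.
have -> : u *m mxC (W x) *m u^t* = (u *m T x) *m (u *m T x)^t*.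
  by rewrite hWT trmx_mul map_mxM !mulmxA.
by rewrite mxE; apply: eq_bigr => k _; rewrite [X in _ * X]mxE [X in Num.conj X]mxE normCK.
Qed.

Lemma weight_quad_ge0 x (u : 'rV[C]_N.+1) :
  0 <= (u *m mxC (W x) *m u^t*) 0 0.
Proof. by rewrite weight_quad sumr_ge0 // => k _; rewrite exprn_ge0. Qed.

Lemma weight_quad_eq0 x (u : 'rV[C]_N.+1) :
  complex.Re ((u *m mxC (W x) *m u^t*) 0 0) = 0 -> u = 0.
Proof.
move=> R0; have q0 : (u *m mxC (W x) *m u^t*) 0 0 = 0.
  apply/eqP; rewrite eq_complex R0 eqxx /=.
  by have := weight_quad_ge0 x u; rewrite lecE => /andP[].
move: q0; rewrite weight_quad => /eqP; rewrite psumr_eq0; last first.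
  by move=> k _; rewrite exprn_ge0.
move/allP => uT; have uT0 : u *m T x = 0.
  apply/rowP => k; have := uT k (mem_index_enum k).
  by rewrite /= sqrf_eq0 normr_eq0 => /eqP ->; rewrite mxE.
have Tu : T x \in unitmx by exact: (factor_unit W hW T hWT x).
by rewrite -[u](mulmxK Tu) uT0 mul0mx.
Qed.

(* If v kills the Gram matrix, the integral of (v p) W (v p)^* vanishes, so v p
   vanishes off a null set although its leading coefficient is v. *)
Lemma gram_unit (p : {poly M}) : p \is monic ->
  form (fun x => mxC (W x)) p p \in unitmx.
Proof.
move=> /monicP p1; have [_ _ mW _] := hW.
set V := fun x => mxC (W x); have hV : moments V := finite_moments_moments W mW.
rewrite -row_free_unit -kermx_eq0; apply/rowV0P => v /sub_kermxP vG.
apply/eqP; apply: contraT => v0.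
have [i vi] : exists i, v 0 i != 0 by apply/rV0Pn.
(* [form] takes square matrix coefficients, so v is repeated in every row; the entry (0, 0) then
   integrates the quadratic form of v p. *)
pose A : M := \matrix_(k < N.+1) v.
have AG : form V (A *: p) (A *: p) = 0.
  rewrite (formZl V _ _ _ hV) (formZr V _ _ _ hV) mulrA.
  have -> : A * form V p p = 0.
    by apply/row_matrixP => k; rewrite -mulmxE row_mul rowK vG row0.
  by rewrite mul0r.
pose phi x := (v *m peval p x%:C *m V x *m (v *m peval p x%:C)^t*) 0 0.
have phiE x : (peval (A *: p) x%:C * V x * (peval (A *: p) x%:C)^t*) 0 0 = phi x.
  have rA : row 0 (peval (A *: p) x%:C) = v *m peval p x%:C.
    by rewrite pevalZ -mulmxE row_mul rowK.
  by rewrite adj_conj_entry rA.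
have [intphi _] : cintegrable phi.
  have := form_integrable V (A *: p) (A *: p) hV 0 0.
  by congr cintegrable; apply/funext => x; rewrite phiE.
have Iphi : Rintegral mu setT (fun x => complex.Re (phi x)) = 0.
  have := congr1 (fun B : M => complex.Re (B 0 0)) AG.
  rewrite /= mxintE mxE /= => <-; apply: eq_Rintegral => x _.
  by rewrite phiE.
(* Entry i of v p. It is nonzero because p is monic, so its coefficient of index deg p is v_i. *)
pose q := \poly_(k < size p) (v *m p`_k) 0 i.
have q0 : q != 0.
  apply: contra_neq vi => /(congr1 (fun r : {poly C} => r`_(size p).-1)).
  rewrite coef0 coef_poly -[p`__]/(lead_coef p) p1 mulmx1 ifT //.
  rewrite ltn_predL size_poly_gt0; apply/eqP => p0.
  by move: p1; rewrite p0 lead_coef0 => /eqP; rewrite eq_sym oner_eq0.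
have phi0 x : 0 <= complex.Re (phi x).
  by have := weight_quad_ge0 x (v *m peval p x%:C); rewrite lecE => /andP[].
(* At some real x that is not a root of q the quadratic form vanishes, which forces v p(x) = 0 and
   hence q(x) = 0. *)
have [x [nr /weight_quad_eq0 px0]] :=
  zero_off_countable _ _ intphi phi0 Iphi (countable_roots q q0).
by case: nr; rewrite /= /root horner_row px0 mxE.
Qed.

End Gram.

(** * Unitary functions on the real line *)

Section UnitaryDerivative.
Context {K : numClosedFieldType} {N : nat}.
Local Notation M := 'M[K]_N.+1.

Lemma cvg_conjC (u : nat -> K) (l : K) : u n @[n --> \oo] --> l ->
  Num.conj (u n) @[n --> \oo] --> Num.conj l.
Proof.
move=> /cvgrPdist_lt ul; apply/cvgrPdist_lt => e e0.
have := ul e e0; apply: filterS => n.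
by rewrite -rmorphB norm_conjC.
Qed.

Lemma cvg_entry (u : nat -> M) (l : M) i j : u n @[n --> \oo] --> l ->
  u n i j @[n --> \oo] --> l i j.
Proof.
by move=> ul; exact: (cvg_comp _ (fun B : M => B i j) ul (@coord_continuous K _ _ i j l)).
Qed.

Lemma cvg_sum_ord n (F : 'I_n -> nat -> K) (l : 'I_n -> K) :
  (forall k, F k m @[m --> \oo] --> l k) ->
  \sum_k F k m @[m --> \oo] --> \sum_k l k.
Proof.
elim: n F l => [|n IHn] F l Fl.
  by under eq_fun do rewrite big_ord0; rewrite big_ord0; exact: cvg_cst.
under eq_fun do rewrite big_ord_recl.
by rewrite big_ord_recl; apply: cvgD; [exact: Fl | apply: IHn => k; exact: Fl].
Qed.

(* Along self-conjugate increments h, the quotient phi of S satisfies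
   phi S^* + S phi^* + h phi phi^* = 0. *)
Lemma unitary_derivative_skew (S : K -> M) (z : K) (h : nat -> K) :
  derivable (S : K^o -> M) z 1 ->
  (forall n, h n != 0) -> (forall n, Num.conj (h n) = h n) ->
  h n @[n --> \oo] --> (0 : K) ->
  S z * (S z)^t* = 1 -> (forall n, S (h n + z) * (S (h n + z))^t* = 1) ->
  derive1 S z * (S z)^t* + S z * (derive1 S z)^t* = 0.
Proof.
move=> dS h_neq0 hconj cvg_h0 Sz Sh.
set L := derive1 S z; set A := S z.
pose phi n := (h n)^-1 *: (S (h n + z) - A).
(* Since no increment is 0, the convergence takes place in the punctured neighbourhood used by the
   derivative. *)
have cvg_h : h n @[n --> \oo] --> (0 : K)^'.
  move=> B B0.
  have hB : \forall n \near \oo, h n != 0 -> B (h n) := cvg_h0 _ B0.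
  change (\forall n \near \oo, B (h n)).
  by apply: filterS hB => n; apply; exact: h_neq0.
have phiL : phi n @[n --> \oo] --> L.
  have dL : t^-1 *: (S (t + z) - S z) @[t --> (0 : K)^'] --> L.
    move: dS; rewrite /derivable /L /derive1.
    under [in X in X -> _]eq_fun do rewrite [_ *: 1]mulr1.
    by [].
  exact: (cvg_comp _ _ cvg_h dL).
have SE n : S (h n + z) = A + h n *: phi n.
  by rewrite scalerA divff // scale1r [RHS]addrC subrK.
(* Expand S S^* = 1 at h + z, where S = A + h phi; subtract A A^* = 1 and divide by h, which equals
   its conjugate. *)
have phi0 n : phi n * A^t* + A * (phi n)^t* + h n *: (phi n * (phi n)^t*) = 0.
  have := Sh n; rewrite SE; move: (phi n) => w.
  rewrite adjD adjZ hconj mulrDl !mulrDr Sz -addrA -[RHS]addr0 => /addrI.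
  rewrite -!scalerAl -!scalerAr -!scalerDr => /eqP.
  rewrite scaler_eq0 (negbTE (h_neq0 n)) /= => /eqP <-.
  by rewrite addrA [_ + w * _]addrC.
clearbody phi.
apply/matrixP => i j; rewrite [RHS]mxE.
have phi0ij n : \sum_k phi n i k * (A^t*) k j
    + \sum_k A i k * Num.conj (phi n j k)
    + h n * \sum_k phi n i k * Num.conj (phi n j k) = 0.
  have := congr1 (fun B : M => B i j) (phi0 n).
  rewrite !mxE => e; rewrite -[RHS]e; congr (_ + _ + _ * _);
    by apply: eq_bigr => k _; rewrite !mxE.
have lhs : (fun n => \sum_k phi n i k * (A^t*) k j
    + \sum_k A i k * Num.conj (phi n j k)
    + h n * \sum_k phi n i k * Num.conj (phi n j k)) @ \oo -->
  \sum_k L i k * (A^t*) k j + \sum_k A i k * Num.conj (L j k)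
    + 0 * \sum_k L i k * Num.conj (L j k).
  apply: cvgD; first apply: cvgD.
  - apply: cvg_sum_ord => k; apply: cvgM; [exact: cvg_entry | exact: cvg_cst].
  - apply: cvg_sum_ord => k; apply: cvgM; first exact: cvg_cst.
    exact/cvg_conjC/cvg_entry.
  - apply: cvgM => //; apply: cvg_sum_ord => k; apply: cvgM; first exact: cvg_entry.
    exact/cvg_conjC/cvg_entry.
rewrite (funext phi0ij) in lhs.
have := cvg_unique (@norm_hausdorff _ _) lhs (cvg_cst _).
rewrite mul0r addr0 => e; rewrite mxE -[RHS]e !mxE.
by congr (_ + _); apply: eq_bigr => k _; rewrite !mxE.
Qed.

End UnitaryDerivative.

Section RealUnitaryDerivative.
Context {R : realType} {N : nat}.
Local Notation C := R[i].
Local Notation M := 'M[R[i]]_N.+1.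

Lemma unitary_on_reals_derivative_skew (S : C -> M) : entire S ->
  (forall x : R, S x%:C \is unitarymx) ->
  forall x : R, derive1 S x%:C * (S x%:C)^t* + S x%:C * (derive1 S x%:C)^t* = 0.
Proof.
move=> hS hSu x.
have unit1 y : S y%:C * (S y%:C)^t* = 1 by exact/unitarymxP.
(* The increments 1/(n+1) are real, so S is unitary at every shifted point. *)
apply: (@unitary_derivative_skew C N S x%:C (fun n => (n.+1%:R^-1 : R)%:C)).
- exact: hS.
- by move=> n; rewrite eq_complex /= eqxx andbT invr_neq0 // pnatr_eq0.
- by move=> n; rewrite conj_complexR.
- apply/cvgr0Pnorm_lt => e; rewrite ltcE /= => /andP[/eqP Ie Re0].
  near=> n.
  rewrite ger0_norm; last by rewrite lecE /= eqxx /= invr_ge0.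
  rewrite ltcE /= Ie eqxx /=; near: n.
  exact: near_infty_natSinv_lt (PosNum Re0).
- exact: unit1.
- by move=> n; rewrite -rmorphD; exact: unit1.
Unshelve. all: by end_near.
Qed.

End RealUnitaryDerivative.

(** * Ladder relations for the weight *)

Section WeightedLadder.
Context {R : realType} {N : nat}.
Local Notation M := 'M[R[i]]_N.+1.
Implicit Types p q s : {poly M}.
Variable W : R -> 'M[R]_N.+1.
Hypothesis hW : is_weight W.
Variable P : nat -> {poly M}.
Hypothesis hP : monic_orthogonal W P.

Let V (x : R) : M := mxC (W x).

Let hV : moments V.
Proof. by case: hW => _ _ mW _; exact: finite_moments_moments. Qed.

Let formC p q : (form V p q)^t* = form V q p.
Proof.
rewrite (form_adj V p q hV); congr (form _ q p).
by apply/funext => x; exact: weight_adj.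
Qed.

Let bcoef_form l k :
  bcoef W P l k = if (l <= k)%N then form V (P l) 'X^k else 0.
Proof.
rewrite /bcoef; case: (l <= k)%N; last by [].
congr mxint; apply/funext => x.
by rewrite peval_Xn adj_scalar mulr_scalar rmorphXn /= conj_complexR.
Qed.

(** The abstract relations for the form of W. The factorization W = T T^* enters through the
    invertibility of the Gram matrices. *)
Lemma weighted_ladder (T : R -> M) (K : {poly M}) (e n : nat) (z : R[i]) :
  (forall x : R, V x = T x *m (T x)^t*) ->
  (forall p q, form V (p^`() *+ e + p * K) q
               = - form V p (q^`() *+ e + q * K)) ->
  (peval ((P n)^`() *+ e + P n * K) z
    = - calB W P n K z *m peval (P n) z
      + star (calA W P n K) z *m betac W P n *m peval (Pprev P n) z) /\
  (peval ((P n)^`() *+ e + P n * K) z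
    = (star (calA W P n K) z *m (z%:M - alphac P n) - calB W P n K z)
        *m peval (P n) z
      - star (calA W P n K) z *m peval (P n.+1) z).
Proof.
move=> hWT skew.
have Psize k : size (P k) = k.+1 by have [] := hP k.
have Pmonic k : P k \is monic by have [] := hP k.
have Porth k q : (size q <= k)%N -> form V (P k) q = 0.
  by have [_ _ h] := hP k; exact: h.
have Punit k : form V (P k) (P k) \is a GRing.unit.
  exact: (gram_unit W T hW hWT (P k) (Pmonic k)).
have gE k : gammac W P k = (form V (P k) (P k))^-1 by [].
split.
- exact: (ladder_relation (form V) (fun p q s => formDl V p q s hV)
    (fun A p q => formZl V A p q hV) (formMX V) formC P Psize Pmonic Porth
    Punit K e skew W gE bcoef_form n z).
- exact: (ladder_relation_next (form V) (fun p q s => formDl V p q s hV)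
    (fun A p q => formZl V A p q hV) (formMX V) formC P Psize Pmonic Porth
    Punit K e skew W gE bcoef_form n z).
Qed.

Lemma derivation_skew (T : R -> M) (G : {poly M}) : csmooth T ->
  (forall x : R, cderive1 T x = peval G x%:C *m T x) ->
  (forall x : R, V x = T x *m (T x)^t*) ->
  forall p q, form V (p^`() *+ 1 + p * G) q = - form V p (q^`() *+ 1 + q * G).
Proof.
move=> hT hTG hWT p q; have [_ _ _ mW'] := hW.
have hV' := finite_moments_moments _ mW'.
apply/eqP; rewrite -addr_eq0 !mulr1n; apply/eqP.
rewrite (formDl V _ _ _ hV) (formDr V _ _ _ hV).
rewrite form_weightMl form_weightMr.
(* By W' = G W + W G^*, the two terms containing G add up to the form with weight W'. *)
have GE : form (fun x => peval G x%:C * V x) p q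
    + form (fun x => V x * (peval G x%:C)^t*) p q
  = form (fun x => mxC (derive1 W x)) p q.
  rewrite -form_weightD.
  - have E : (fun x => peval G x%:C * V x + V x * (peval G x%:C)^t*)
        = (fun x => mxC (derive1 W x)).
      by apply/funext => x; exact: (weight_derivativeE W hW T G hT hTG hWT x).
    exact: (congr1 (fun U => form U p q) E).
  - exact: moments_peval.
  - have := moments_adj _ (moments_peval G _ (moments_adj _ hV)).
    by congr moments; apply/funext => x; rewrite adjM adjK.
have sum0 (a b c d v : M) : b + d = v -> a + v + c = 0 -> a + b + (c + d) = 0.
  by move=> <-; rewrite addrACA addrAC.
exact: (sum0 _ _ _ _ _ GE
  (form_skew_derivative V _ p q hV hV' (form_weight_derivative W hW))).
Qed.

Lemma multiplication_skew (H : {poly M}) :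
  (forall x : R, peval H x%:C * V x + V x * (peval H x%:C)^t* = 0) ->
  forall p q, form V (p^`() *+ 0 + p * H) q = - form V p (q^`() *+ 0 + q * H).
Proof.
move=> HV p q; apply/eqP; rewrite -addr_eq0 !mulr0n !add0r; apply/eqP.
rewrite form_weightMl form_weightMr -form_weightD.
- by rewrite (funext HV); exact: form_weight0.
- exact: moments_peval.
- have := moments_adj _ (moments_peval H _ (moments_adj _ hV)).
  by congr moments; apply/funext => x; rewrite adjM adjK.
Qed.

End WeightedLadder.

Lemma multiplier_skew (R : realType) (N : nat) (T : R -> 'M[R[i]]_N.+1)
    (Tc S : R[i] -> 'M[R[i]]_N.+1) (H : {poly 'M[R[i]]_N.+1}) (x : R) :
  Tc x%:C = T x -> T x \in unitmx -> entire S ->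
  (forall y : R, S y%:C \is unitarymx) ->
  peval H x%:C
    = Tc x%:C *m derive1 S x%:C *m star S x%:C *m invmx (Tc x%:C) ->
  peval H x%:C * (T x *m (T x)^t*) + T x *m (T x)^t* * (peval H x%:C)^t* = 0.
Proof.
move=> TcT Tu hS hSu ->; rewrite TcT /star conj_complexR !mulmxE.
set D := derive1 S x%:C; set A := S x%:C.
rewrite -[invmx _]/((T x)^-1).
have TV : (T x)^t* * ((T x)^-1)^t* = 1 by rewrite -adjM mulVr // adj1.
have -> : T x * D * A^t* * (T x)^-1 * (T x * (T x)^t*)
    = T x * (D * A^t*) * (T x)^t*.
  by rewrite mulrA -[_ * _ * T x]mulrA mulVr // mulr1 !mulrA.
have -> : T x * (T x)^t* * (T x * D * A^t* * (T x)^-1)^t*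
    = T x * (A * D^t*) * (T x)^t*.
  by rewrite !adjM adjK -!mulrA [(T x)^t* * (_ * _)]mulrA TV mul1r.
by rewrite -mulrDl -mulrDr unitary_on_reals_derivative_skew // mulr0 mul0r.
Qed.

(** With q = P_(n-1), the two brackets reduce to A b q and A' b q, and A A'^-1 carries the second to
    the first. *)
Lemma eliminate_previous (F : comUnitRingType) (n : nat)
    (A B A' B' b p q : 'M[F]_n) : A' \in unitmx ->
  - B *m p + A *m b *m q + B *m p
  - A *m invmx A' *m (- B' *m p + A' *m b *m q + B' *m p) = 0.
Proof.
move=> uA'; have cancel (X Y : 'M[F]_n) : - X *m p + Y + X *m p = Y.
  by rewrite mulNmx addrC addrA subrr add0r.
by rewrite !cancel !mulmxA mulmxKV // subrr.
Qed.

Theorem corollary3p8 (R : realType) (N : nat)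
  (W : R -> 'M[R]_N.+1) (hW : is_weight W)
  (P : nat -> {poly 'M[R[i]]_N.+1}) (hP : monic_orthogonal W P)
  (G : {poly 'M[R[i]]_N.+1})
  (* T on the real line and its extension Tc to the complex plane *)
  (T : R -> 'M[R[i]]_N.+1) (hT : csmooth T)
  (hTG : forall x : R, cderive1 T x = peval G x%:C *m T x)
  (hWT : forall x : R, mxC (W x) = T x *m (T x) ^t*)
  (Tc : R[i] -> 'M[R[i]]_N.+1) (hTc : entire Tc)
  (hTcT : forall x : R, Tc x%:C = T x)
  (S : R[i] -> 'M[R[i]]_N.+1) (hS : entire S)
  (hSnonconst : ~ exists A : 'M[R[i]]_N.+1, forall z : R[i], S z = A)
  (hSunit : forall z : R[i], S z \in unitmx)
  (hSunitary : forall x : R, S x%:C \is unitarymx)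
  (H : {poly 'M[R[i]]_N.+1})
  (hH : forall z : R[i],
      peval H z = Tc z *m derive1 S z *m star S z *m invmx (Tc z)) :
  forall n : nat,
    (forall z : R[i],
      [/\ peval (P n)^`() z + peval (P n) z *m peval G z
          = - calB W P n G z *m peval (P n) z
            + star (calA W P n G) z *m betac W P n *m peval (Pprev P n) z,
          peval (P n)^`() z + peval (P n) z *m peval G z
          = (star (calA W P n G) z *m (z%:M - alphac P n) - calB W P n G z)
              *m peval (P n) z
            - star (calA W P n G) z *m peval (P n.+1) z,
          peval (P n) z *m peval H z
          = - calB W P n H z *m peval (P n) z
            + star (calA W P n H) z *m betac W P n *m peval (Pprev P n) z
        & peval (P n) z *m peval H z
          = (star (calA W P n H) z *m (z%:M - alphac P n) - calB W P n H z)
              *m peval (P n) z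
            - star (calA W P n H) z *m peval (P n.+1) z])
    /\ ((forall z : R[i], calA W P n G z \in unitmx) ->
        forall z : R[i],
          peval (P n) z *m peval H z + calB W P n H z *m peval (P n) z
          - star (calA W P n H) z *m invmx (star (calA W P n G) z)
            *m (peval (P n)^`() z + peval (P n) z *m peval G z
                + calB W P n G z *m peval (P n) z) = 0).
Proof.
have hHW x : peval H x%:C * mxC (W x) + mxC (W x) * (peval H x%:C)^t* = 0.
  rewrite !hWT; apply: (multiplier_skew R N T Tc S H x) => //.
  exact: (factor_unit W hW T hWT x).
move=> n.
have relG z : (peval (P n)^`() z + peval (P n) z *m peval G z
    = - calB W P n G z *m peval (P n) z
      + star (calA W P n G) z *m betac W P n *m peval (Pprev P n) z) /\
  (peval (P n)^`() z + peval (P n) z *m peval G z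
    = (star (calA W P n G) z *m (z%:M - alphac P n) - calB W P n G z)
        *m peval (P n) z
      - star (calA W P n G) z *m peval (P n.+1) z).
  have := weighted_ladder W hW P hP T G 1 n z hWT
    (derivation_skew W hW T G hT hTG hWT).
  by rewrite mulr1n pevalD pevalM.
have relH z : (peval (P n) z *m peval H z
    = - calB W P n H z *m peval (P n) z
      + star (calA W P n H) z *m betac W P n *m peval (Pprev P n) z) /\
  (peval (P n) z *m peval H z
    = (star (calA W P n H) z *m (z%:M - alphac P n) - calB W P n H z)
        *m peval (P n) z
      - star (calA W P n H) z *m peval (P n.+1) z).
  have := weighted_ladder W hW P hP T H 0 n z hWT
    (multiplication_skew W hW H hHW).
  by rewrite mulr0n add0r pevalM.
split=> [z|Aunit z].
  by have [G1 G2] := relG z; have [H1 H2] := relH z; split.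
have [-> _] := relG z; have [-> _] := relH z.
(* Invertibility of [calA] is used at the conjugate of z and passes to the adjoint. *)
have Gunit : star (calA W P n G) z \in unitmx.
  by rewrite map_unitmx unitmx_tr.
exact: eliminate_previous.
Qed.
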